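(* Let $M$ be a $C^\infty$ real hypersurface in $\mathbb{C}^n$ and let $p\in M$. If there exists a holomorphic coordinate $(z)$ at $p$ with $p=0$ on which a local defining function $r$ for $M$ is nondegenerate, then $$\Delta_1(M,p)=\Delta_1^{\mathrm{reg}}(M,p)=\rho_1(M,p;(z)).$$
   Context: A local defining function for $M$ near $p$ is a real-valued $C^\infty$ function $r$ near $p$ with $M=\{r=0\}$ near $p$ and $\nabla r\neq 0$ on $r=0$. For a $C^\infty$ map $h$ near $0\in\mathbb{C}$ with values in $\mathbb{C}$ or $\mathbb{C}^n$ and $h(0)=0$, $\mathrm{ord}(h)$ is the order of vanishing at $0$ (smallest total degree in $t,\bar t$ of a nonzero Taylor term; minimum over components for vector-valued maps; $\infty$ if all derivatives vanish at $0$). $\Gamma$ is the set of germs of holomorphic maps $\gamma:(\mathbb{C},0)\to(\mathbb{C}^n,p)$ with $\gamma\not\equiv p$, and $\Gamma_{\mathrm{reg}}\subset\Gamma$ those with $\mathrm{ord}(\gamma-p)=1$. The singular and regular types are $$\Delta_1(M,p)=\sup_{\gamma\in\Gamma}\frac{\mathrm{ord}(r\circ\gamma)}{\mathrm{ord}(\gamma-p)},\qquad \Delta_1^{\mathrm{reg}}(M,p)=\sup_{\gamma\in\Gamma_{\mathrm{reg}}}\mathrm{ord}(r\circ\gamma)$$ (values in $\mathbb{N}$, resp. $\mathbb R$, or $\infty$). For a germ $F$ of a $C^\infty$ function at $0\in\mathbb{C}^n$ with $F(0)=0$ and Taylor series $\sum C_{\alpha\beta}z^\alpha\bar z^\beta$,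 the Newton polyhedron $\mathcal{N}_+(F)$ is the convex hull of $\bigcup\{\alpha+\beta+\mathbb{R}_{\ge0}^n:C_{\alpha\beta}\ne0\}$ in $\mathbb{R}^n$. Put $\rho_j(F)=\min\{\xi_j>0:(0,\dots,\xi_j,\dots,0)\in\mathcal{N}_+(F)\}$ ($j$-th slot), $\infty$ if $\mathcal{N}_+(F)$ does not meet the $\xi_j$-axis. $F$ is convenient if $\mathcal{N}_+(F)$ meets every coordinate axis. For a holomorphic coordinate $(z)$ at $p$ and a local defining function $r$ written in it, $\rho_1(M,p;(z))=\max_{1\le j\le n}\rho_j(r)$ if $r$ is convenient and $\infty$ otherwise. Nondegeneracy. A vector $a\in\mathbb{N}^n$ (positive integers) determines a nonempty bounded face $\kappa$ of $\mathcal{N}_+(F)$ if, for some $l\in\mathbb N$, $\mathcal{N}_+(F)\subset\{\langle a,\xi\rangle\ge l\}$ and $\kappa=\mathcal{N}_+(F)\cap\{\langle a,\xi\rangle=l\}$. Faces of all dimensions, including vertices, are considered. The $\kappa$-part of $F$ is $F_\kappa(z,\bar z)=\sum_{\alpha+\beta\in\kappa}C_{\alpha\beta}z^\alpha\bar z^\beta$. $F_\kappa$ is nondegenerate if $F_\kappa\circ\gamma\not\equiv0$ for every curve $\gamma(t)=(c_1t^{a_1},\dots,c_nt^{a_n})$ with $c\in(\mathbb{C}\setminus\{0\})^n$ and $a\in\mathbb{N}^n$ determining $\kappa$. $F$ is nondegenerate if $F_\kappa$ is nondegenerate for every bounded face $\kappa$ of $\mathcal{N}_+(F)$. *)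

(* Defs.v *)
From mathcomp Require Export all_boot all_order all_algebra.
From mathcomp Require Export all_classical all_reals all_analysis.
From mathcomp Require Export complex.

Set Implicit Arguments.
Unset Strict Implicit.
Unset Printing Implicit Defensive.

Import Order.TTheory GRing.Theory Num.Theory.
Import numFieldNormedType.Exports.

Local Open Scope classical_set_scope.
Local Open Scope complex_scope.
Local Open Scope ring_scope.

(** * Real structure of C^n *)

(* C^n is ['rV[R[i]]_n].  Its topology and real differential calculus are those
   of the real normed space R^n x R^n, through z = x + iy <-> (x, y). *)

Section RealStructure.
Variables (R : realType) (n : nat).
Local Notation E := ('rV[R]_n * 'rV[R]_n)%type.

Definition of_real (v : E) : 'rV[R[i]]_n := \row_j (v.1 0 j +i* v.2 0 j).

Definition to_real (z : 'rV[R[i]]_n) : E :=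
  (\row_j complex.Re (z 0 j), \row_j complex.Im (z 0 j)).

Definition cnbhs (p : 'rV[R[i]]_n) : set_system 'rV[R[i]]_n :=
  of_real x @[x --> to_real p].

Definition dir_x (j : 'I_n) : E := (delta_mx 0 j, 0).
Definition dir_y (j : 'I_n) : E := (0, delta_mx 0 j).

Definition rpartial (v : E) (f : 'rV[R[i]]_n -> R) (z : 'rV[R[i]]_n) : R :=
  'D_v (f \o of_real) (to_real z).

Definition gradient (f : 'rV[R[i]]_n -> R) (z : 'rV[R[i]]_n) : E :=
  (\row_j rpartial (dir_x j) f z, \row_j rpartial (dir_y j) f z).

(* In finite dimension, f is C^oo on an open set iff all its iterated
   directional derivatives are (Frechet) differentiable there. *)
Definition smooth_at (f : 'rV[R[i]]_n -> R) (p : 'rV[R[i]]_n) : Prop :=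
  \forall x \near to_real p, forall vs : seq E,
    differentiable (foldr (fun v (g : E -> R) => 'D_v g) (f \o of_real) vs) x.

Definition csmooth_at (f : 'rV[R[i]]_n -> R[i]) (p : 'rV[R[i]]_n) : Prop :=
  smooth_at (fun z => complex.Re (f z)) p /\
  smooth_at (fun z => complex.Im (f z)) p.

Definition cpartial (v : E) (f : 'rV[R[i]]_n -> R[i]) (z : 'rV[R[i]]_n) : R[i] :=
  rpartial v (fun w => complex.Re (f w)) z
  +i* rpartial v (fun w => complex.Im (f w)) z.

(* Wirtinger operators d/dz_j and d/d(conj z_j). *)
Definition dz (j : 'I_n) (f : 'rV[R[i]]_n -> R[i]) (z : 'rV[R[i]]_n) : R[i] :=
  2^-1 * (cpartial (dir_x j) f z - ('i)%C * cpartial (dir_y j) f z).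

Definition dzbar (j : 'I_n) (f : 'rV[R[i]]_n -> R[i]) (z : 'rV[R[i]]_n) : R[i] :=
  2^-1 * (cpartial (dir_x j) f z + ('i)%C * cpartial (dir_y j) f z).

(* The coefficient C_{alpha beta} of z^alpha (conj z)^beta in the Taylor series
   of F at 0. *)
Definition taylor_coef (F : 'rV[R[i]]_n -> R[i])
    (alpha beta : {ffun 'I_n -> nat}) : R[i] :=
  foldr (fun j G => iter (alpha j) (dz j) (iter (beta j) (dzbar j) G))
        F (enum 'I_n) 0
  / (\prod_j ((alpha j)`! * (beta j)`!)%N)%:R.

End RealStructure.

(** * Holomorphic maps, curves and orders of vanishing *)

Section Holomorphic.
Variable R : realType.

(* f is C^oo and satisfies the Cauchy-Riemann equations near p. *)
Definition holomorphic_at m n (f : 'rV[R[i]]_m -> 'rV[R[i]]_n)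
    (p : 'rV[R[i]]_m) : Prop :=
  forall k : 'I_n,
    csmooth_at (fun z => f z 0 k) p /\
    \forall z \near cnbhs p, forall j : 'I_m, dzbar j (fun w => f w 0 k) z = 0.

(* Functions of one complex variable, seen as functions on C^1. *)
Definition onC1 (T : Type) (h : R[i] -> T) : 'rV[R[i]]_1 -> T :=
  fun z => h (z 0 0).

(* The infimum of a set of naturals is a minimum, or +oo if the set is empty. *)
Definition order (h : R[i] -> R[i]) : \bar R :=
  ereal_inf [set d%:R%:E | d in [set d : nat | exists a b : nat,
    d = (a + b)%N /\ taylor_coef (onC1 h) [ffun=> a] [ffun=> b] <> 0]].

Definition vorder n (h : R[i] -> 'rV[R[i]]_n) : \bar R :=
  \big[mine/+oo%E]_(j < n) order (fun t => h t 0 j).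

Variable n : nat.

Definition Gamma (p : 'rV[R[i]]_n) : set (R[i] -> 'rV[R[i]]_n) :=
  [set gamma | [/\ holomorphic_at (onC1 gamma) 0, gamma 0 = p &
                   ~ \forall t \near cnbhs (0 : 'rV[R[i]]_1), onC1 gamma t = p]].

Definition Gamma_reg (p : 'rV[R[i]]_n) : set (R[i] -> 'rV[R[i]]_n) :=
  [set gamma | Gamma p gamma /\ vorder (fun t => gamma t - p) = 1%E].

(* A holomorphic coordinate at p, vanishing at p, given by the map zeta from
   the old coordinates to the new ones and its local inverse phi. *)
Definition holomorphic_coordinate (p : 'rV[R[i]]_n)
    (zeta phi : 'rV[R[i]]_n -> 'rV[R[i]]_n) : Prop :=
  [/\ holomorphic_at zeta p, holomorphic_at phi 0, zeta p = 0, phi 0 = p &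
      (\forall z \near cnbhs p, phi (zeta z) = z) /\
      (\forall w \near cnbhs (0 : 'rV[R[i]]_n), zeta (phi w) = w)].

End Holomorphic.

(** * Hypersurfaces and types *)

Section Hypersurface.
Variables (R : realType) (n : nat).

Definition local_defining_function (M : set 'rV[R[i]]_n) (p : 'rV[R[i]]_n)
    (r : 'rV[R[i]]_n -> R) : Prop :=
  [/\ smooth_at r p,
      \forall z \near cnbhs p, M z <-> r z = 0 &
      \forall z \near cnbhs p, r z = 0 -> gradient r z <> 0].

Definition smooth_real_hypersurface (M : set 'rV[R[i]]_n) : Prop :=
  forall p, M p -> exists r, local_defining_function M p r.

(* [Delta1 p r] and [Delta1_reg p r] compute the types at p of the hypersurface
   of which r is a local defining function. *)
Definition Delta1 (p : 'rV[R[i]]_n) (r : 'rV[R[i]]_n -> R) : \bar R :=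
  ereal_sup [set (order (fun t => (r (gamma t))%:C) /
                  vorder (fun t => (gamma t - p)%R))%E | gamma in Gamma p].

Definition Delta1_reg (p : 'rV[R[i]]_n) (r : 'rV[R[i]]_n -> R) : \bar R :=
  ereal_sup [set order (fun t => (r (gamma t))%:C) | gamma in Gamma_reg p].

End Hypersurface.

(** * Newton polyhedra *)

Section Newton.
Variables (R : realType) (n : nat).
Implicit Types (F : 'rV[R[i]]_n -> R[i]) (a : {ffun 'I_n -> nat}).

Definition exponent (alpha beta : {ffun 'I_n -> nat}) : 'rV[R]_n :=
  \row_j (alpha j + beta j)%:R.

Definition newton_polyhedron F : set 'rV[R]_n :=
  smallest (@convex_set R 'rV[R]_n)
    [set xi | exists alpha beta, taylor_coef F alpha beta <> 0 /\
                forall j, exponent alpha beta 0 j <= xi 0 j].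

(* The minimum (attained when F(0) = 0), or +oo if there is no such point. *)
Definition rho F (j : 'I_n) : \bar R :=
  ereal_inf [set x%:E | x in
    [set x : R | 0 < x /\ newton_polyhedron F (x *: delta_mx 0 j)]].

Definition convenient F : Prop :=
  forall j : 'I_n, exists x : R, newton_polyhedron F (x *: delta_mx 0 j).

Definition rho1 F : \bar R :=
  if `[< convenient F >] then \big[maxe/-oo%E]_(j < n) rho F j else +oo%E.

Definition pairing a (xi : 'rV[R]_n) : R := \sum_j (a j)%:R * xi 0 j.

(* The positive integer vector a determines the nonempty (bounded) face kappa. *)
Definition determines F a (kappa : set 'rV[R]_n) : Prop :=
  [/\ forall j, (0 < a j)%N, kappa !=set0 & exists l : nat,
      newton_polyhedron F `<=` [set xi | l%:R <= pairing a xi] /\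
      kappa = newton_polyhedron F `&` [set xi | pairing a xi = l%:R]].

Definition bounded_face F (kappa : set 'rV[R]_n) : Prop :=
  exists a, determines F a kappa.

(* For a bounded face kappa the sum has finitely many terms, as required by
   [\sum_(_ \in _)]. *)
Definition kappa_part F (kappa : set 'rV[R]_n) (z : 'rV[R[i]]_n) : R[i] :=
  \sum_(ab \in [set ab : {ffun 'I_n -> nat} * {ffun 'I_n -> nat} |
                  kappa (exponent ab.1 ab.2)])
    (taylor_coef F ab.1 ab.2 *
     \prod_j (z 0 j ^+ ab.1 j * ((z 0 j)^*)%C ^+ ab.2 j)).

Definition nondegenerate_part F (kappa : set 'rV[R]_n) : Prop :=
  forall (c : 'rV[R[i]]_n) a, (forall j, c 0 j != 0) -> determines F a kappa ->
  exists t : R[i], kappa_part F kappa (\row_j (c 0 j * t ^+ a j)) <> 0.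

Definition nondegenerate F : Prop :=
  forall kappa, bounded_face F kappa -> nondegenerate_part F kappa.

End Newton.

(* Main.v *)
(** Orders of vanishing are read off from growth: by Taylor's formula a smooth
    function h on C has order >= d at 0 iff h(t) = O(|t|^d).  Two defining
    functions of M dominate each other near p up to constants (move from a point
    to M along a transverse line), so they have the same order along every
    curve, and rho_j(r) is the order of r along the j-th coordinate axis.

    Let gamma be a curve and eta = (eta_j) its expression in the coordinate (z),
    with eta_j = c_j t^(a_j) + higher order terms; give a huge weight a_j to the
    components that are flat.  On the face kappa of minimal weight l for a,
    r o eta = r_kappa(c t^a) + O(|t|^(l+1)), and r_kappa(c t^a) is homogeneous of
    degree l and nonzero by nondegeneracy, so ord(r o eta) = l.  The point of the
    polyhedron on the j-th axis gives l <= a_j rho_j(r), and the component of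
    least order yields ord(r o gamma) <= ord(gamma - p) rho_1.  The coordinate
    axes are regular curves and realize the supremum. *)
From HB Require Import structures.
Require Import Defs.
From mathcomp Require Import ring lra zify.
Set Implicit Arguments.
Unset Strict Implicit.
Unset Printing Implicit Defensive.
Import Order.TTheory GRing.Theory Num.Theory.
Import numFieldNormedType.Exports.
Local Open Scope classical_set_scope.
Local Open Scope complex_scope.
Local Open Scope ring_scope.

(** * Smooth functions on a normed space *)

Lemma near_open (T : topologicalType) (p : T) (P : T -> Prop) :
  (\forall x \near p, P x) -> exists V, [/\ open V, V p & forall x, V x -> P x].
Proof.
move=> nP; exists (P : set T)^°; split=> //; first exact: open_interior.
exact: interior_subset.
Qed.

Lemma near_forall (T : topologicalType) (I : finType) (p : T) (P : I -> T -> Prop) :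
  (forall i, \forall x \near p, P i x) -> \forall x \near p, forall i, P i x.
Proof. by move=> nP; exact: filter_forall. Qed.

Section SmoothOn.
Variables (R : realType) (V : normedModType R).
Implicit Types (U : set V) (f g : V -> R) (u v x : V).

Definition iderive (vs : seq V) f : V -> R :=
  foldr (fun v (g : V -> R) => 'D_v g) f vs.

Lemma iderive_rcons vs v f : iderive (rcons vs v) f = iderive vs ('D_v f).
Proof. by rewrite /iderive foldr_rcons. Qed.

Definition Ck k U f := forall vs x, (size vs <= k)%N -> U x ->
  differentiable (iderive vs f) x.

Definition smooth_on U f := forall vs x, U x -> differentiable (iderive vs f) x.

Lemma smooth_onP U f : smooth_on U f <-> forall k, Ck k U f.
Proof.
split=> [s k vs x _|s vs x]; first exact: s.
exact: (s (size vs)).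
Qed.

Lemma CkS k U f : Ck k.+1 U f <->
  (forall x, U x -> differentiable f x) /\ forall v, Ck k U ('D_v f).
Proof.
split=> [s|[s0 s] vs].
  split=> [x|v vs x ks]; first exact: (s [::]).
  by rewrite -iderive_rcons; apply: s; rewrite size_rcons.
case/lastP: vs => [x _|vs v x]; first exact: s0.
by rewrite size_rcons iderive_rcons; exact: s.
Qed.

Lemma Ck0 U f : Ck 0 U f <-> forall x, U x -> differentiable f x.
Proof. by split=> [s x|s [|//] x _]; [exact: (s [::])|exact: s]. Qed.

Lemma Ck_diff k U f x : Ck k U f -> U x -> differentiable f x.
Proof. by move=> /(_ [::] x isT). Qed.

Lemma open_near_eq U f g x : open U -> (forall y, U y -> f y = g y) -> U x ->
  \forall y \near x, f y = g y.
Proof.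
move=> oU fg Ux; have : \forall y \near x, U y by exact: open_nbhs_nbhs.
by apply: filterS => y; exact: fg.
Qed.

Lemma derive_ext U f g : open U -> (forall y, U y -> f y = g y) ->
  forall v y, U y -> 'D_v f y = 'D_v g y.
Proof.
by move=> oU fg v y Uy; apply: near_eq_derive; exact: open_near_eq fg Uy.
Qed.

Lemma differentiable_ext f g x : (\forall y \near x, f y = g y) ->
  differentiable f x -> differentiable g x.
Proof.
move=> fg df; rewrite -[g](subrK f) addrC; apply: differentiableD => //.
set e := g - f; have e0 : \forall y \near x, e y = 0.
  by apply: filterS fg => y fgy; rewrite /e !fctE fgy subrr.
have e0' : \forall h \near 0, e (h + x) = 0.
  by move: e0; rewrite (near_shift 0); apply: filterS => h; rewrite subr0.
have zc : continuous (\0 : {linear V -> R}) by move=> z; exact: cvg_cst.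
have eE : e \o shift x = cst (e x) + (\0 : {linear V -> R}) +o_ 0 id.
  apply/eqaddoP => eps eps0; apply: filterS e0' => h eh.
  rewrite [X in `|X|](_ : _ = 0); first by rewrite normr0 mulr_ge0// ltW.
  by rewrite !fctE /= eh (nbhs_singleton e0) addr0 subr0.
by apply/diff_locallyP; rewrite (diff_unique zc eE).
Qed.

Lemma iderive_ext U f g vs : open U -> (forall y, U y -> f y = g y) ->
  forall y, U y -> iderive vs f y = iderive vs g y.
Proof.
by move=> oU fg; elim: vs => //= v vs IH y Uy; exact: derive_ext IH v y Uy.
Qed.

Lemma Ck_ext k U f g : open U -> (forall y, U y -> f y = g y) ->
  Ck k U f -> Ck k U g.
Proof.
move=> oU fg s vs x ks Ux; apply: differentiable_ext (s vs x ks Ux).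
exact: open_near_eq (iderive_ext vs oU fg) Ux.
Qed.

Lemma CkW k U f : Ck k.+1 U f -> Ck k U f.
Proof. by move=> s vs x ks; apply: s; rewrite leqW. Qed.

Lemma Ck_cst k U (c : R) : Ck k U (fun=> c).
Proof.
elim: k c => [|k IH] c; first by apply/Ck0 => x _; exact: differentiable_cst.
apply/CkS; split=> [x _|v]; first exact: differentiable_cst.
suff -> : 'D_v (fun=> c) = (fun=> 0) by exact: IH.
by apply/funext => x; exact: (derive_cst c).
Qed.

Lemma CkD k U f g : open U -> Ck k U f -> Ck k U g ->
  Ck k U (fun x => f x + g x).
Proof.
move=> oU; elim: k f g => [|k IH] f g.
  move=> /Ck0 sf /Ck0 sg; apply/Ck0 => x Ux.
  by apply: differentiableD; [exact: sf|exact: sg].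
move=> /CkS[df sf] /CkS[dg sg]; apply/CkS; split=> [x Ux|v].
  by apply: differentiableD; [exact: df|exact: dg].
apply: Ck_ext oU _ (IH _ _ (sf v) (sg v)) => y Uy.
by rewrite -deriveD//; apply: diff_derivable; [exact: df|exact: dg].
Qed.

Lemma CkM k U f g : open U -> Ck k U f -> Ck k U g ->
  Ck k U (fun x => f x * g x).
Proof.
move=> oU; elim: k f g => [|k IH] f g.
  move=> /Ck0 sf /Ck0 sg; apply/Ck0 => x Ux.
  by apply: differentiableM; [exact: sf|exact: sg].
move=> sf' sg'; have /CkS[df sf] := sf'; have /CkS[dg sg] := sg'.
apply/CkS; split=> [x Ux|v].
  by apply: differentiableM; [exact: df|exact: dg].
have := CkD oU (IH _ _ (CkW sf') (sg v)) (IH _ _ (CkW sg') (sf v)).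
apply: Ck_ext oU _ => y Uy.
by rewrite -deriveM//; apply: diff_derivable; [exact: df|exact: dg].
Qed.

Lemma Ck_sum k U (I : Type) (r : seq I) (F : I -> V -> R) : open U ->
  (forall i, Ck k U (F i)) -> Ck k U (fun x => \sum_(i <- r) F i x).
Proof.
move=> oU s; elim: r => [|i r IH].
  by under [X in Ck _ _ X]funext => x do rewrite big_nil; exact: Ck_cst.
by under [X in Ck _ _ X]funext => x do rewrite big_cons; exact: CkD.
Qed.

End SmoothOn.

Section Composition.
Variables (R : realType) (V W : normedModType R) (I : finType) (e : I -> W).
Implicit Types (U : set V) (f : W -> R) (g : I -> V -> R).

Local Notation comb g := (fun x => \sum_i g i x *: e i).

Lemma differentiable_comb g x : (forall i, differentiable (g i) x) ->
  differentiable (comb g) x.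
Proof.
move=> dg; have -> : comb g = \sum_i (fun x => g i x *: e i).
  by apply/funext => y; rewrite fct_sumE.
elim/big_ind: _ => [|f h|i _]; first exact: differentiable_cst.
  exact: differentiableD.
exact: differentiableZl.
Qed.

Lemma diff_comb g x v : (forall i, differentiable (g i) x) ->
  'd (comb g) x v = \sum_i 'D_v (g i) x *: e i.
Proof.
move=> dg; have cE : comb g = \sum_i (fun x => g i x *: e i).
  by apply/funext => y; rewrite fct_sumE.
suff : is_diff x (comb g) (fun v => \sum_i 'd (g i) x v *: e i).
  move=> /(@diff_val _ _ _ _ _ _ _) ->.
  by apply: eq_bigr => i _; rewrite deriveE.
rewrite cE; have -> : (fun v => \sum_i 'd (g i) x v *: e i) =
    \sum_i (fun v => 'd (g i) x v *: e i).
  by apply/funext => y; rewrite fct_sumE.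
elim/big_ind2: _ => [|f df h dh|i _]; first exact: is_diff_cst.
  exact: is_diffD.
apply: DiffDef; first exact: differentiableZl.
by rewrite diffZl.
Qed.

Lemma derive_comb g f x v : (forall i, differentiable (g i) x) ->
  differentiable f (comb g x) ->
  'D_v (fun y => f (comb g y)) x =
  \sum_i 'D_v (g i) x * 'D_(e i) f (comb g x).
Proof.
move=> dg df; have dc := differentiable_comb dg.
rewrite deriveE; last exact: differentiable_comp dc df.
rewrite (diff_comp dc df) /= diff_comb// linear_sum.
by apply: eq_bigr => i _; rewrite linearZ (deriveE _ df).
Qed.

Lemma Ck_comp k U (U' : set W) g f : open U -> open U' ->
  (forall x, U x -> U' (comb g x)) ->
  (forall i, Ck k U (g i)) -> Ck k U' f -> Ck k U (fun x => f (comb g x)).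
Proof.
move=> oU oU' gU; elim: k g f gU => [|k IH] g f gU.
  move=> sg /Ck0 sf; apply/Ck0 => x Ux.
  apply: (@differentiable_comp _ _ _ _ (comb g)); last exact/sf/gU.
  by apply: differentiable_comb => i; exact: Ck_diff (sg i) Ux.
move=> sg sf'; have /CkS[df sf] := sf'; apply/CkS; split=> [x Ux|v].
  apply: (@differentiable_comp _ _ _ _ (comb g)); last exact/df/gU.
  by apply: differentiable_comb => i; exact: Ck_diff (sg i) Ux.
suff : Ck k U (fun x => \sum_i 'D_v (g i) x * 'D_(e i) f (comb g x)).
  apply: Ck_ext => // y Uy; rewrite derive_comb//; last exact/df/gU.
  by move=> i; exact: Ck_diff (sg i) Uy.
apply: Ck_sum => // i; apply: CkM => //.
  by have /CkS[_ /(_ v)] := sg i.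
by apply: (IH g ('D_(e i) f) gU) => [j|]; [exact: CkW (sg j)|exact: sf].
Qed.

End Composition.

Section Schwarz.
Variables (R : realType) (V : normedModType R).
Implicit Types (U : set V) (f : V -> R) (u v x : V).

Lemma is_derive_line f x v (s : R) : derivable f (x + s *: v) v ->
  is_derive s 1 (fun s => f (x + s *: v)) ('D_v f (x + s *: v)).
Proof.
have E : (fun h : R => h^-1 *: (f (x + (h *: 1 + s) *: v) - f (x + s *: v)))
       = (fun h : R => h^-1 *: (f (h *: v + (x + s *: v)) - f (x + s *: v))).
  apply/funext => h; congr (_ *: (f _ - _)).
  by rewrite [h *: 1]mulr1 scalerDl addrCA.
by move=> df; split; rewrite /derivable /derive ?/shift /= E.
Qed.

Lemma MVT_line f x v (h : R) : 0 <= h ->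
  (forall s, 0 <= s <= h -> differentiable f (x + s *: v)) ->
  exists2 s, 0 <= s <= h & f (x + h *: v) - f x = h * 'D_v f (x + s *: v).
Proof.
move=> h0 df; pose F (s : R) := f (x + s *: v).
have dF (s : R) : 0 <= s <= h -> is_derive s 1 F ('D_v f (x + s *: v)).
  by move=> sh; apply: is_derive_line; exact/diff_derivable/df.
have dF1 s : s \in `]0, h[ -> is_derive s 1 F ('D_v f (x + s *: v)).
  by rewrite in_itv/= => /andP[s0 sh]; apply: dF; rewrite !ltW.
have cF : {within `[0, h], continuous F}.
  apply: continuous_in_subspaceT => s; rewrite inE/= in_itv/= => sh.
  apply: differentiable_continuous; apply/derivable1_diffP.
  by case: (dF s sh).
have [s sh] := MVT_segment h0 dF1 cF.
rewrite /F scale0r addr0 subr0 mulrC => ->; exists s => //.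
Qed.

(* Both mixed derivatives are the limit of the same second difference
   quotient, by two applications of the mean value theorem. *)
Lemma second_difference U f u v x : open U -> smooth_on U f -> U x ->
  forall eps, 0 < eps -> \forall h \near (0 : R)^'+,
  `|f (x + h *: u + h *: v) - f (x + h *: u) - (f (x + h *: v) - f x)
    - h ^+ 2 * 'D_v ('D_u f) x| <= h ^+ 2 * eps.
Proof.
move=> oU sf Ux eps eps0.
have c : {for x, continuous ('D_v ('D_u f))}.
  by apply: differentiable_continuous; exact: (sf [:: v; u]).
have : \forall y \near x, U y /\ `|'D_v ('D_u f) x - 'D_v ('D_u f) y| < eps.
  apply: filterI; first exact: open_nbhs_nbhs.
  exact: (@cvgr_dist_lt _ _ _ _ _ _ _ c _ eps0).
move=> /nbhs_normP[d /= d0 dP].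
have uv0 : 0 < `|u| + `|v| + 1 by rewrite ltr_wpDl// addr_ge0.
have near_xst h s t : 0 < h -> h < d / (`|u| + `|v| + 1) ->
    0 <= s <= h -> 0 <= t <= h -> U (x + s *: u + t *: v) /\
    `|'D_v ('D_u f) x - 'D_v ('D_u f) (x + s *: u + t *: v)| < eps.
  move=> h0 hd /andP[s0 sh] /andP[t0 th]; apply: dP.
  rewrite /ball_ /= opprD addrA opprD addrA subrr sub0r.
  rewrite -opprD normrN (le_lt_trans (ler_normD _ _))// !normrZ.
  rewrite !ger0_norm//; move: hd; rewrite ltr_pdivlMr// => hd.
  rewrite (le_lt_trans _ hd)// !mulrDr mulr1 -[leLHS]addr0 lerD ?(ltW h0)//.
  by rewrite lerD// ler_wpM2r.
near=> h; have h0 : 0 < h by near: h; exact: nbhs_right_gt.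
have hd : h < d / (`|u| + `|v| + 1).
  by near: h; apply: nbhs_right_lt; rewrite divr_gt0.
have hh : 0 <= h <= h by rewrite ltW/=.
pose F y := f (y + h *: v) - f y.
have dshift w t : U (w + t) -> differentiable (fun y => f (y + t)) w.
  move=> Uw; apply: (@differentiable_comp _ _ _ _ (fun y => y + t)).
    exact: differentiableD.
  exact: (sf [::]).
have Dshift w t : 'D_u (fun y => f (y + t)) w = 'D_u f (w + t).
  by rewrite /derive /shift /=; under eq_fun do rewrite -addrA.
have Uf s : 0 <= s <= h -> U (x + s *: u).
  move=> sh; have h00 : 0 <= (0 : R) <= h by apply/andP; split; [exact: lexx|exact: ltW].
  by have [] := near_xst h s 0 h0 hd sh h00; rewrite scale0r addr0.
have [s sh] : exists2 s, 0 <= s <= h & F (x + h *: u) - F x = h * 'D_u F (x + s *: u).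
  apply: MVT_line; first exact: ltW.
  move=> s sh; apply: differentiableB; last exact/(sf [::])/Uf.
  by apply: dshift; case: (near_xst h s h).
rewrite {1 2}/F deriveB; last 2 first.
- by apply/diff_derivable/dshift; case: (near_xst h s h).
- by apply/diff_derivable/(sf [::])/Uf.
rewrite Dshift opprD opprK.
have [|t th ->] := @MVT_line ('D_u f) (x + s *: u) v h (ltW h0).
  by move=> t th; apply: (sf [:: u]); case: (near_xst h s t).
move=> ->; rewrite mulrA -expr2 -mulrBr normrM ger0_norm ?exprn_ge0 ?ltW//.
rewrite distrC ltr_pM2l ?exprn_gt0//.
by case: (near_xst h s t).
Unshelve. all: by end_near. Qed.

Lemma schwarz U f : open U -> smooth_on U f ->
  forall u v x, U x -> 'D_u ('D_v f) x = 'D_v ('D_u f) x.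
Proof.
move=> oU sf u v x Ux; apply/eqP; rewrite -subr_eq0 -normr_le0.
apply/ler_addgt0Pr => eps eps0; rewrite add0r.
have e0 : 0 < eps / 2 by rewrite divr_gt0.
have K1 := second_difference u v oU sf Ux e0.
have K2 := second_difference v u oU sf Ux e0.
have [h [[H1 H2] h0]] := filter_ex (filterI (filterI K1 K2) (nbhs_right_gt (0 : R))).
rewrite -(@ler_pM2l _ (h ^+ 2)) ?exprn_gt0//.
rewrite -[X in X * `|_|]ger0_norm ?exprn_ge0 ?(ltW h0)// -normrM.
rewrite [in leRHS](splitr eps) [in leRHS]mulrDr.
apply: le_trans (lerD H1 H2); rewrite [in leRHS](addrAC x (h *: v)).
rewrite -[X in _ <= _ + X]normrN.
move: (f _) (f _) (f _) (f _) ('D_u _ x) ('D_v _ x) (h ^+ 2) => a b c d A B k.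
apply: le_trans (ler_normD _ _); rewrite le_eqVlt; apply/orP; left.
apply/eqP; congr `|_|; ring.
Qed.

End Schwarz.

(** * Wirtinger calculus *)

Local Notation normc := ComplexField.Normc.normc.

Section Modulus.
Variable R : realType.
Implicit Types (z w : R[i]) (s : R).

Lemma normcM z w : normc (z * w) = normc z * normc w.
Proof. exact: ComplexField.Normc.normcM. Qed.

Lemma normcD z w : normc (z + w) <= normc z + normc w.
Proof. exact: le_normcD. Qed.

Lemma normc_ge0 z : 0 <= normc z.
Proof. by case: z => a b; exact: sqrtr_ge0. Qed.

Lemma normc_0 : normc (0 : R[i]) = 0.
Proof. exact: ComplexField.Normc.normc0. Qed.

Lemma normc_le0 z : normc z <= 0 -> z = 0.
Proof.
move=> z0; apply: ComplexField.Normc.eq0_normc; apply/eqP.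
by rewrite eq_le z0 normc_ge0.
Qed.

Lemma normcX z k : normc (z ^+ k) = normc z ^+ k.
Proof.
elim: k => [|k IH]; first by rewrite !expr0 ComplexField.Normc.normc1.
by rewrite !exprS normcM IH.
Qed.

Lemma normc_sum (I : Type) (r : seq I) (P : pred I) (F : I -> R[i]) :
  normc (\sum_(i <- r | P i) F i) <= \sum_(i <- r | P i) normc (F i).
Proof.
elim/big_ind2: _ => [|a b c d ab cd|//]; first by rewrite normc_0.
by rewrite (le_trans (normcD _ _))// lerD.
Qed.

Lemma normc_real s : normc s%:C = `|s|.
Proof. by rewrite /= expr0n/= addr0 sqrtr_sqr. Qed.

Lemma normc_conj z : normc z^*%C = normc z.
Proof. by case: z => a b /=; rewrite sqrrN. Qed.

Lemma normc_Re z : `|complex.Re z| <= normc z.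
Proof.
case: z => a b /=; rewrite -sqrtr_sqr ler_sqrt ?addr_ge0 ?sqr_ge0//.
by rewrite lerDl sqr_ge0.
Qed.

Lemma normc_Im z : `|complex.Im z| <= normc z.
Proof.
case: z => a b /=; rewrite -sqrtr_sqr ler_sqrt ?addr_ge0 ?sqr_ge0//.
by rewrite lerDr sqr_ge0.
Qed.

Lemma normc_ReIm z : normc z <= `|complex.Re z| + `|complex.Im z|.
Proof.
rewrite [in leLHS](complexE z) (le_trans (normcD _ _))// normcM !normc_real /=.
by rewrite expr0n expr1n/= add0r sqrtr1 mul1r.
Qed.

End Modulus.

Section ComplexCalculus.
Variables (R : realType) (n : nat).
Local Notation E := ('rV[R]_n * 'rV[R]_n)%type.
Local Notation L := (bool * 'I_n)%type.
Implicit Types (U : set E) (F G : E -> R[i]) (v x : E) (l m : L).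

Definition csmooth_on U F :=
  smooth_on U (fun x => complex.Re (F x)) /\
  smooth_on U (fun x => complex.Im (F x)).

Definition cderive v F x : R[i] :=
  'D_v (fun y => complex.Re (F y)) x +i* 'D_v (fun y => complex.Im (F y)) x.

(* The letters (false, j) and (true, j) stand for z_j and conj z_j. *)
Definition letter l x : R[i] :=
  if l.1 then x.1 0 l.2 -i* x.2 0 l.2 else x.1 0 l.2 +i* x.2 0 l.2.

Definition wirtinger l F x : R[i] :=
  2^-1 * (cderive (dir_x R l.2) F x +
          (if l.1 then 'i%C else - 'i%C) * cderive (dir_y R l.2) F x).

Definition cdifferentiable F x :=
  differentiable (fun y => complex.Re (F y)) x /\
  differentiable (fun y => complex.Im (F y)) x.

Lemma csmooth_diff U F x : csmooth_on U F -> U x -> cdifferentiable F x.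
Proof. by move=> [sr si] Ux; split; [exact: (sr [::])|exact: (si [::])]. Qed.

Lemma csmooth_ext U F G : open U -> (forall y, U y -> F y = G y) ->
  csmooth_on U F -> csmooth_on U G.
Proof.
move=> oU FG [/smooth_onP sr /smooth_onP si]; split; apply/smooth_onP => k.
  by apply: Ck_ext oU _ (sr k) => y Uy; rewrite FG.
by apply: Ck_ext oU _ (si k) => y Uy; rewrite FG.
Qed.

Lemma csmooth_cst U (c : R[i]) : csmooth_on U (fun=> c).
Proof. by split; apply/smooth_onP => k; exact: Ck_cst. Qed.

Lemma csmoothD U F G : open U -> csmooth_on U F -> csmooth_on U G ->
  csmooth_on U (fun x => F x + G x).
Proof.
move=> oU [/smooth_onP Fr /smooth_onP Fi] [/smooth_onP Gr /smooth_onP Gi].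
split; apply/smooth_onP => k.
  by under [X in Ck _ _ X]funext => x do rewrite raddfD/=; exact: CkD.
by under [X in Ck _ _ X]funext => x do rewrite raddfD/=; exact: CkD.
Qed.

Lemma csmoothM U F G : open U -> csmooth_on U F -> csmooth_on U G ->
  csmooth_on U (fun x => F x * G x).
Proof.
move=> oU [/smooth_onP Fr /smooth_onP Fi] [/smooth_onP Gr /smooth_onP Gi].
have ReM (z w : R[i]) : complex.Re (z * w) = complex.Re z * complex.Re w
    + -1 * (complex.Im z * complex.Im w).
  by case: z w => a b [c d] /=; rewrite mulN1r.
have ImM (z w : R[i]) : complex.Im (z * w) = complex.Re z * complex.Im w
    + complex.Im z * complex.Re w.
  by case: z w => a b [c d] /=; rewrite [b * c]mulrC.
split; apply/smooth_onP => k.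
  under [X in Ck _ _ X]funext => x do rewrite ReM.
  apply: CkD => //; first exact: CkM.
  by apply: CkM => //; [exact: Ck_cst|exact: CkM].
by under [X in Ck _ _ X]funext => x do rewrite ImM; apply: CkD => //; exact: CkM.
Qed.

Lemma csmooth_sum U (I : Type) (r : seq I) (F : I -> E -> R[i]) : open U ->
  (forall i, csmooth_on U (F i)) -> csmooth_on U (fun x => \sum_(i <- r) F i x).
Proof.
move=> oU s; elim: r => [|i r IH].
  under [X in csmooth_on _ X]funext => x do rewrite big_nil.
  exact: csmooth_cst.
by under [X in csmooth_on _ X]funext => x do rewrite big_cons; exact: csmoothD.
Qed.

Lemma csmooth_cderive U F v : csmooth_on U F -> csmooth_on U (cderive v F).
Proof.
move=> [sr si]; split => vs x Ux.
  by have := sr (rcons vs v) x Ux; rewrite iderive_rcons.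
by have := si (rcons vs v) x Ux; rewrite iderive_rcons.
Qed.

Lemma csmooth_wirtinger U F l : open U -> csmooth_on U F ->
  csmooth_on U (wirtinger l F).
Proof.
move=> oU sF; apply: csmoothM => //; first exact: csmooth_cst.
apply: csmoothD => //; first exact: csmooth_cderive.
by apply: csmoothM => //; [exact: csmooth_cst|exact: csmooth_cderive].
Qed.

Lemma cderive_ext U F G v x : open U -> (forall y, U y -> F y = G y) -> U x ->
  cderive v F x = cderive v G x.
Proof.
move=> oU FG Ux; congr (_ +i* _); apply: (derive_ext oU _ v Ux) => y Uy.
  by rewrite FG.
by rewrite FG.
Qed.

Lemma wirtinger_ext U F G l x : open U -> (forall y, U y -> F y = G y) -> U x ->
  wirtinger l F x = wirtinger l G x.
Proof. by move=> oU FG Ux; congr (_ * (_ + _ * _)); exact: cderive_ext Ux. Qed.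

Lemma derive_lin (a b : R) (f g : E -> R) v x : differentiable f x ->
  differentiable g x ->
  'D_v (fun y => a * f y + b * g y) x = a * 'D_v f x + b * 'D_v g x.
Proof.
move=> /(@diff_derivable _ _ _ _ _ v) df /(@diff_derivable _ _ _ _ _ v) dg.
transitivity ('D_v (a *: f + b *: g) x); first by [].
have da : derivable (a *: f) x v by exact: derivableZ.
have db : derivable (b *: g) x v by exact: derivableZ.
rewrite (deriveD da db); apply: f_equal2.
  exact: deriveZ df.
exact: deriveZ dg.
Qed.

Lemma cderiveD F G v x : cdifferentiable F x -> cdifferentiable G x ->
  cderive v (fun y => F y + G y) x = cderive v F x + cderive v G x.
Proof.
move=> [Fr Fi] [Gr Gi]; rewrite /cderive.
under eq_fun do rewrite raddfD/=.
under [X in _ +i* 'D__ X _]funext => y do rewrite raddfD/=.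
by rewrite -[RHS]/(_ +i* _); congr (_ +i* _); apply: deriveD; exact: diff_derivable.
Qed.

Lemma cderiveZ (c : R[i]) F v x : cdifferentiable F x ->
  cderive v (fun y => c * F y) x = c * cderive v F x.
Proof.
case: c => a b [Fr Fi]; rewrite /cderive.
have -> : (fun y => complex.Re ((a +i* b) * F y)) =
    (fun y => a * complex.Re (F y) + (- b) * complex.Im (F y)).
  by apply/funext => y; case: (F y) => c d /=; rewrite mulNr.
have -> : (fun y => complex.Im ((a +i* b) * F y)) =
    (fun y => a * complex.Im (F y) + b * complex.Re (F y)).
  by apply/funext => y; case: (F y).
by rewrite !derive_lin//= mulNr.
Qed.

Lemma cdifferentiableZ (c : R[i]) F x : cdifferentiable F x ->
  cdifferentiable (fun y => c * F y) x.
Proof.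
case: c => a b [Fr Fi]; split.
  have -> : (fun y => complex.Re ((a +i* b) * F y)) =
    (a *: (fun y => complex.Re (F y))) + (- b) *: (fun y => complex.Im (F y)).
    by apply/funext => y; rewrite !fctE; case: (F y) => c d /=; rewrite scaleNr.
  by apply: differentiableD; exact: differentiableZ.
have -> : (fun y => complex.Im ((a +i* b) * F y)) =
  (a *: (fun y => complex.Im (F y))) + b *: (fun y => complex.Re (F y)).
  by apply/funext => y; rewrite !fctE; case: (F y) => c d /=.
by apply: differentiableD; exact: differentiableZ.
Qed.

Lemma cdifferentiableD F G x : cdifferentiable F x -> cdifferentiable G x ->
  cdifferentiable (fun y => F y + G y) x.
Proof.
move=> [Fr Fi] [Gr Gi]; split.
  by under [X in differentiable X _]funext => y do rewrite raddfD/=;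
     exact: differentiableD.
by under [X in differentiable X _]funext => y do rewrite raddfD/=;
   exact: differentiableD.
Qed.

Lemma cderive_comm U F u v x : open U -> csmooth_on U F -> U x ->
  cderive u (cderive v F) x = cderive v (cderive u F) x.
Proof.
move=> oU [sr si] Ux.
exact: (f_equal2 (@Complex R) (schwarz oU sr u v Ux) (schwarz oU si u v Ux)).
Qed.

Lemma cderive_wirtinger U F v l x : open U -> csmooth_on U F -> U x ->
  cderive v (wirtinger l F) x = wirtinger l (cderive v F) x.
Proof.
move=> oU sF Ux; have scd w := csmooth_diff (csmooth_cderive w sF) Ux.
pose c : R[i] := if l.1 then 'i%C else - 'i%C.
have dcF := cdifferentiableZ c (scd (dir_y R l.2)).
etransitivity; first exact: cderiveZ (cdifferentiableD (scd _) dcF).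
apply: f_equal; etransitivity; first exact: (cderiveD v (scd _) dcF).
apply: f_equal2; first exact: cderive_comm Ux.
etransitivity; first exact: (cderiveZ c v (scd _)).
by apply: f_equal; exact: cderive_comm Ux.
Qed.

Lemma wirtinger_comm U F l m x : open U -> csmooth_on U F -> U x ->
  wirtinger l (wirtinger m F) x = wirtinger m (wirtinger l F) x.
Proof.
move=> oU sF Ux.
have cdw p w := cderive_wirtinger w p oU sF Ux.
pose c (k : L) : R[i] := if k.1 then 'i%C else - 'i%C.
have [B BE BC] : exists2 B : E -> E -> R[i],
    forall k k', wirtinger k (wirtinger k' F) x = 2^-1 *
      (2^-1 * (B (dir_x R k'.2) (dir_x R k.2) + c k' * B (dir_y R k'.2) (dir_x R k.2)) +
       c k * (2^-1 * (B (dir_x R k'.2) (dir_y R k.2) + c k' * B (dir_y R k'.2) (dir_y R k.2))))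
    & forall u v, B u v = B v u.
  exists (fun u v => cderive u (cderive v F) x) => [k k'|u v].
    exact: (f_equal2 (fun a b => 2^-1 * (a + c k * b)) (cdw k' _) (cdw k' _)).
  exact: cderive_comm oU sF Ux.
rewrite (BE l m) (BE m l) (BC (dir_x R m.2) (dir_x R l.2)).
rewrite (BC (dir_x R m.2) (dir_y R l.2)) (BC (dir_y R m.2) (dir_x R l.2)).
rewrite (BC (dir_y R m.2) (dir_y R l.2)).
ring.
Qed.

(* The chain rule for z = x + iy, rewritten in z and its conjugate. *)
Lemma cderive_letter F v x : cdifferentiable F x ->
  cderive v F x = \sum_l letter l v * wirtinger l F x.
Proof.
move=> [Fr Fi].
have vE : v = \sum_(j < n) v.1 0 j *: dir_x R j + \sum_(j < n) v.2 0 j *: dir_y R j.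
  case: v => v1 v2; rewrite (surjective_pairing (_ + _)) !raddfD/= !raddf_sum/=.
  rewrite [X in (_ + X, _)]big1 ?addr0; last by move=> i _; rewrite scaler0.
  rewrite [X in (_, X + _)]big1 ?add0r; last by move=> i _; rewrite scaler0.
  by rewrite -!row_sum_delta.
have DE (f : E -> R) : differentiable f x -> 'D_v f x =
    \sum_(j < n) (v.1 0 j * 'D_(dir_x R j) f x + v.2 0 j * 'D_(dir_y R j) f x).
  move=> df; rewrite deriveE// [in LHS]vE linearD !linear_sum -big_split/=.
  by apply: eq_bigr => j _; rewrite !linearZ !deriveE.
transitivity (\sum_(j < n) ((v.1 0 j)%:C * cderive (dir_x R j) F x +
    (v.2 0 j)%:C * cderive (dir_y R j) F x)).
  have sumC (a b : 'I_n -> R) :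
      (\sum_j a j) +i* (\sum_j b j) = \sum_j (a j +i* b j).
    by apply/eqP; rewrite eq_complex !raddf_sum/= !eqxx.
  rewrite /cderive !DE// sumC; apply: eq_bigr => j _.
  move: ('D_(dir_x R j) _ x) ('D_(dir_x R j) _ x).
  move: ('D_(dir_y R j) _ x) ('D_(dir_y R j) _ x) => a b c d.
  apply/eqP; rewrite eq_complex /= !mul0r !subr0 !addr0 !eqxx//.
rewrite -(pair_bigA _ (fun b j => letter (b, j) v * wirtinger (b, j) F x))/=.
rewrite big_bool/= -big_split/=; apply: eq_bigr => j _.
rewrite /letter /wirtinger /=.
move: (cderive _ F x) (cderive _ F x) => A B.
have i2 : 'i%C * 'i%C = -1 :> R[i] by rewrite -expr2 sqr_i.
rewrite [v.1 0 j -i* _](_ : _ = (v.1 0 j)%:C - 'i%C * (v.2 0 j)%:C); last first.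
  by rewrite [LHS]complexE /= raddfN mulrN.
rewrite [v.1 0 j +i* _]complexE /=.
move: (v.1 0 j)%:C (v.2 0 j)%:C => a b.
rewrite -[b * A]opprK -mulN1r -i2; move: ('i%C : R[i]) => I.
by field.
Qed.

End ComplexCalculus.

(** * Orders of vanishing at the origin *)

Section BigO.
Variables (R : realType) (n : nat).
Local Notation E := ('rV[R]_n * 'rV[R]_n)%type.
Implicit Types (F G : E -> R[i]) (x : E) (d k : nat).

Definition vanishes d F :=
  exists C : R, \forall x \near (0 : E), normc (F x) <= C * `|x| ^+ d.

Lemma vanishes_pos d F : vanishes d F ->
  exists2 C : R, 0 < C & \forall x \near (0 : E), normc (F x) <= C * `|x| ^+ d.
Proof.
move=> [C HC]; exists (`|C| + 1); first by rewrite ltr_wpDl.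
apply: filterS HC => x Hx; apply: le_trans Hx _.
by rewrite ler_wpM2r ?exprn_ge0// (le_trans (ler_norm _))// lerDl.
Qed.

Lemma near0_le1 : \forall x \near (0 : E), `|x| <= 1.
Proof.
apply/nbhs_normP; exists 1 => //= x; rewrite /ball_/= sub0r normrN.
exact: ltW.
Qed.

Lemma vanishesW d d' F : (d' <= d)%N -> vanishes d F -> vanishes d' F.
Proof.
move=> dd' /vanishes_pos[C C0 HC]; exists C.
apply: filterS2 near0_le1 HC => x x1 Hx; apply: le_trans Hx _.
by rewrite ler_pM2l// ler_wiXn2l.
Qed.

Lemma vanishes_near d F G : (\forall x \near (0 : E), F x = G x) ->
  vanishes d F -> vanishes d G.
Proof. by move=> FG [C HC]; exists C; apply: filterS2 FG HC => x ->. Qed.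

Lemma vanishes_le d F G (C : R) : 0 <= C ->
  (\forall x \near (0 : E), normc (G x) <= C * normc (F x)) ->
  vanishes d F -> vanishes d G.
Proof.
move=> C0 FG [D HD]; exists (C * D); apply: filterS2 FG HD => x H1 H2.
by rewrite (le_trans H1)// -mulrA ler_wpM2l.
Qed.

Lemma vanishes0 d : vanishes d (fun=> 0).
Proof.
by exists 0; apply: filterE => x; rewrite normc_0 mul0r.
Qed.

Lemma vanishesD d F G : vanishes d F -> vanishes d G ->
  vanishes d (fun x => F x + G x).
Proof.
move=> [C HC] [D HD]; exists (C + D); apply: filterS2 HC HD => x HC HD.
by rewrite (le_trans (normcD _ _))// mulrDl lerD.
Qed.

Lemma vanishesM d d' F G : vanishes d F -> vanishes d' G ->
  vanishes (d + d') (fun x => F x * G x).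
Proof.
move=> [C HC] [D HD]; exists (C * D); apply: filterS2 HC HD => x HC HD.
by rewrite normcM exprD mulrACA ler_pM ?normc_ge0.
Qed.

Lemma vanishes_cst (c : R[i]) : vanishes 0 (fun=> c).
Proof. by exists (normc c); apply: filterE => x; rewrite expr0 mulr1. Qed.

Lemma vanishesZ d (c : R[i]) F : vanishes d F -> vanishes d (fun x => c * F x).
Proof. by move=> HF; rewrite -[d]add0n; exact: vanishesM (vanishes_cst c) HF. Qed.

Lemma vanishesB d F G : vanishes d F -> vanishes d G ->
  vanishes d (fun x => F x - G x).
Proof.
move=> HF HG; apply: vanishesD => //.
have := vanishesZ (-1) HG; apply: vanishes_near.
by apply: filterE => x; rewrite mulN1r.
Qed.

Lemma vanishes_sum d (I : Type) (r : seq I) (F : I -> E -> R[i]) :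
  (forall i, vanishes d (F i)) -> vanishes d (fun x => \sum_(i <- r) F i x).
Proof.
move=> HF; elim: r => [|i r IH].
  by under [X in vanishes _ X]funext => x do rewrite big_nil; exact: vanishes0.
by under [X in vanishes _ X]funext => x do rewrite big_cons; exact: vanishesD.
Qed.

Lemma vanishes_conj d F : vanishes d F -> vanishes d (fun x => (F x)^*%C).
Proof. by move=> [C HC]; exists C; apply: filterS HC => x; rewrite normc_conj. Qed.

Lemma vanishes_homogeneous d F : (forall (s : R) x, F (s *: x) = s%:C ^+ d * F x) ->
  vanishes d.+1 F -> forall x, F x = 0.
Proof.
move=> Fs [C /nbhs_normP[e /= e0 HC]] x.
apply: normc_le0; apply/ler_addgt0Pr => eps eps0; rewrite add0r.
pose D := (`|C| + 1) * (`|x| + 1) ^+ d.+1.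
have D0 : 0 < D by rewrite mulr_gt0 ?exprn_gt0// ltr_wpDl.
have x0 : 0 < `|x| + 1 by rewrite ltr_wpDl.
pose s := Num.min (e / (`|x| + 1) / 2) (eps / D).
have s0 : 0 < s by rewrite lt_min !divr_gt0.
have sx : `|s *: x| < e.
  rewrite normrZ gtr0_norm// (le_lt_trans (y := s * (`|x| + 1)))//.
    by rewrite ler_wpM2l ?(ltW s0)// lerDl.
  rewrite -ltr_pdivlMr//; apply: (@le_lt_trans _ _ (e / (`|x| + 1) / 2)).
    by rewrite ge_min lexx.
  by rewrite ltr_pdivrMr// ltr_pMr ?divr_gt0// ltr1n.
have /HC : ball_ Num.Def.normr 0 e (s *: x) by rewrite /ball_/= sub0r normrN.
rewrite Fs normcM normcX normc_real normrZ exprMn gtr0_norm// exprSr.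
rewrite mulrCA -!mulrA ler_pM2l ?exprn_gt0// => H.
apply: (le_trans H); apply: (@le_trans _ _ (s * D)).
  rewrite ler_wpM2l ?(ltW s0)//.
  apply: (@le_trans _ _ (`|C| * `|x| ^+ d.+1)).
    by rewrite ler_wpM2r ?exprn_ge0// ler_norm.
  by rewrite ler_pM ?exprn_ge0// ?lerDl// lerXn2r ?nnegrE ?addr_ge0// lerDl.
by rewrite -ler_pdivlMr// ge_min lexx orbT.
Qed.

End BigO.

(** * Taylor expansion *)

Section Taylor.
Variables (R : realType) (n : nat).
Local Notation E := ('rV[R]_n * 'rV[R]_n)%type.
Local Notation L := (bool * 'I_n)%type.
Implicit Types (U : set E) (F G : E -> R[i]) (v x : E) (l m : L).

Definition csmooth0 F := exists U, [/\ open U, U 0 & csmooth_on U F].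

Lemma csmooth0_wirtinger F l : csmooth0 F -> csmooth0 (wirtinger l F).
Proof. by move=> [U [oU U0 sF]]; exists U; split=> //; exact: csmooth_wirtinger. Qed.

Lemma coord_norm x j : `|x.1 0 j| <= `|x| /\ `|x.2 0 j| <= `|x|.
Proof.
have mxn (M : 'rV[R]_n) : `|M 0 j| <= `|M|.
  by rewrite [leRHS]mx_normrE (le_trans _ (le_bigmax _ _ (0, j))).
rewrite prod_normE; split; rewrite (le_trans (mxn _))//.
  by rewrite le_max lexx.
by rewrite le_max lexx orbT.
Qed.

Lemma letter_norm l x : normc (letter l x) <= 2 * `|x|.
Proof.
case: l => b j; have [x1 x2] := coord_norm x j.
rewrite (le_trans (normc_ReIm _))// mulr2n mulrDl mul1r.
by rewrite /letter; case: b; rewrite /= ?normrN lerD.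
Qed.

Lemma vanishes_letter l : vanishes 1 (@letter R n l).
Proof. by exists 2; apply: filterE => x; rewrite expr1; exact: letter_norm. Qed.

Lemma letterZ l (s : R) x : letter l (s *: x) = s%:C * letter l x.
Proof.
by case: l => [[] j]; rewrite /letter /= !mxE; apply/eqP;
  rewrite eq_complex /= !mul0r ?subr0 ?addr0 ?mulrN !eqxx.
Qed.

Lemma Ck_linear k (f : {linear E -> R}) : continuous f -> Ck k setT f.
Proof.
move=> cf; case: k => [|k]; first by apply/Ck0 => x _; exact: linear_differentiable.
apply/CkS; split=> [x _|v]; first exact: linear_differentiable.
suff -> : 'D_v f = (fun=> f v) by exact: Ck_cst.
apply/funext => x; rewrite deriveE; last exact: linear_differentiable.
by rewrite diff_lin.
Qed.

Lemma smooth_coord U j : smooth_on U (fun x : E => x.1 0 j) /\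
  smooth_on U (fun x : E => x.2 0 j).
Proof.
have lin1 : linear (fun x : E => x.1 0 j) by move=> a x y /=; rewrite !mxE.
have lin2 : linear (fun x : E => x.2 0 j) by move=> a x y /=; rewrite !mxE.
pose f1 : {linear E -> R} := HB.pack (fun x : E => x.1 0 j)
  (GRing.isLinear.Build _ _ _ _ _ lin1).
pose f2 : {linear E -> R} := HB.pack (fun x : E => x.2 0 j)
  (GRing.isLinear.Build _ _ _ _ _ lin2).
have c1 : continuous f1.
  move=> x; apply: (@continuous_comp _ _ _ fst (fun M : 'rV[R]_n => M 0 j)).
    exact: cvg_fst.
  exact: coord_continuous.
have c2 : continuous f2.
  move=> x; apply: (@continuous_comp _ _ _ snd (fun M : 'rV[R]_n => M 0 j)).
    exact: cvg_snd.
  exact: coord_continuous.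
split=> vs x _.
  exact: (Ck_linear c1 (leqnn (size vs)) I).
exact: (Ck_linear c2 (leqnn (size vs)) I).
Qed.

Lemma csmooth_letter U l : open U -> csmooth_on U (@letter R n l).
Proof.
case: l => b j oU; have [s1 s2] := smooth_coord U j.
case: b; split => //; apply/smooth_onP => k /=; rewrite /letter /=.
under [X in Ck _ _ X]funext => x do rewrite -mulN1r.
by apply: CkM => //; [exact: Ck_cst|move/smooth_onP: s2; exact].
Qed.

(* The homogeneous part of degree k of the Taylor series, through Euler's identity. *)
Fixpoint taylor_term k F x : R[i] :=
  if k is k'.+1 then
    k%:R^-1 * \sum_l letter l x * taylor_term k' (wirtinger l F) x
  else F 0.

Lemma taylor_termZ k F (s : R) x :
  taylor_term k F (s *: x) = s%:C ^+ k * taylor_term k F x.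
Proof.
elim: k F => [|k IH] F; first by rewrite expr0 mul1r.
rewrite /= mulrCA; congr (_ * _); rewrite mulr_sumr; apply: eq_bigr => l _.
by rewrite letterZ IH exprS mulrACA.
Qed.

Lemma vanishes_taylor_term k F : vanishes k (taylor_term k F).
Proof.
elim: k F => [|k IH] F; first exact: (vanishes_cst n (F 0)).
apply: vanishesZ; apply: vanishes_sum => l.
by rewrite -add1n; apply: vanishesM; [exact: vanishes_letter|exact: IH].
Qed.

Lemma derive_homogeneous k (f : E -> R) (c : R) x (s : R) :
  (forall s, f (s *: x) = s ^+ k.+1 * c) ->
  'D_x f (s *: x) = k.+1%:R * s ^+ k * c.
Proof.
move=> fE; transitivity ('D_1 (c \*o (fun t : R => t ^+ k.+1)) s).
  rewrite /derive; have -> : (fun h : R => h^-1 *: ((f \o shift (s *: x)) (h *: x) - f (s *: x)))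
    = (fun h : R => h^-1 *: (((c \*o (fun t : R => t ^+ k.+1)) \o shift s) (h *: 1) - (c \*o (fun t : R => t ^+ k.+1)) s)).
    apply/funext => h; rewrite /shift /= -scalerDl !fE [h *: 1]mulr1.
    by rewrite ![c * _]mulrC.
  by [].
rewrite deriveMl; last exact: exprn_derivable.
rewrite exp_derive mulrC. by rewrite [_ *: 1]mulr1.
Qed.

Lemma csmooth_taylor_term U k F : open U -> csmooth_on U (taylor_term k F).
Proof.
move=> oU; elim: k F => [|k IH] F; first exact: (csmooth_cst U (F 0)).
apply: csmoothM => //; first exact: csmooth_cst.
apply: csmooth_sum => // l; apply: csmoothM => //; exact: csmooth_letter.
Qed.

Lemma cderive_taylor_term k F x (s : R) :
  cderive x (taylor_term k.+1 F) (s *: x) =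
  \sum_l letter l x * taylor_term k (wirtinger l F) (s *: x).
Proof.
set c := taylor_term k.+1 F x.
have ReX (t : R) j z : complex.Re (t%:C ^+ j * z) = t ^+ j * complex.Re z.
  by rewrite -rmorphXn; case: z => a b /=; rewrite mul0r subr0.
have ImX (t : R) j z : complex.Im (t%:C ^+ j * z) = t ^+ j * complex.Im z.
  by rewrite -rmorphXn; case: z => a b /=; rewrite mul0r addr0.
rewrite /cderive (@derive_homogeneous k _ (complex.Re c)); last first.
  by move=> t; rewrite taylor_termZ ReX.
rewrite (@derive_homogeneous k _ (complex.Im c)); last first.
  by move=> t; rewrite taylor_termZ ImX.
under eq_bigr do rewrite taylor_termZ mulrCA.
rewrite -mulr_sumr.
have -> : \sum_l letter l x * taylor_term k (wirtinger l F) x = k.+1%:R * c.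
  by rewrite /c /= mulrA divff ?mul1r// pnatr_eq0.
rewrite mulrCA -[k.+1%:R in RHS](rmorph_nat (real_complex R)).
rewrite -rmorphXn mulrA -rmorphM /=.
by case: c => a b; apply/eqP; rewrite eq_complex /= !mul0r subr0 addr0 !eqxx.
Qed.

Lemma cderive_cst (c : R[i]) v x : cderive v (fun=> c) x = 0.
Proof. by rewrite /cderive !derive_cst. Qed.

Lemma cdifferentiable_sum (I : Type) (r : seq I) (F : I -> E -> R[i]) x :
  (forall i, cdifferentiable (F i) x) ->
  cdifferentiable (fun y => \sum_(i <- r) F i y) x.
Proof.
move=> dF; elim: r => [|i r IH].
  under [X in cdifferentiable X]funext => y do rewrite big_nil.
  by split; exact: differentiable_cst.
under [X in cdifferentiable X]funext => y do rewrite big_cons.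
exact: cdifferentiableD.
Qed.

Lemma cderive_sum (I : Type) (r : seq I) (F : I -> E -> R[i]) v x :
  (forall i, cdifferentiable (F i) x) ->
  cderive v (fun y => \sum_(i <- r) F i y) x = \sum_(i <- r) cderive v (F i) x.
Proof.
move=> dF; elim: r => [|i r IH].
  rewrite big_nil -[RHS](cderive_cst 0 v x); congr (cderive _ _ _).
  by apply/funext => y; rewrite big_nil.
rewrite big_cons -IH -(cderiveD v (dF i) (cdifferentiable_sum r dF)).
apply: (congr1 (fun G => cderive v G x)).
by apply/funext => y; rewrite big_cons.
Qed.

Lemma taylor_expansion N F : csmooth0 F ->
  vanishes N (fun x => F x - \sum_(k < N) taylor_term k F x).
Proof.
elim: N F => [|N IH] F [U [oU U0 sF]].
  exists (normc (F 0) + 2); have [cr ci] := csmooth_diff sF U0.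
  have nHr := @cvgr_dist_lt _ _ _ _ _ _ _ (differentiable_continuous cr) _ ltr01.
  have nHi := @cvgr_dist_lt _ _ _ _ _ _ _ (differentiable_continuous ci) _ ltr01.
  apply: filterS2 (nHr _) (nHi _) => x Hr Hi.
  rewrite big_ord0 subr0 expr0 mulr1.
  rewrite -[F x](subrK (F 0)) (le_trans (normcD _ _))// addrC lerD//.
  rewrite (le_trans (normc_ReIm _))// !raddfB/= lerD// ltW// distrC.
    exact: Hr.
  exact: Hi.
have /choice[C HC] : forall l, exists C : R, \forall x \near (0 : E),
    normc (wirtinger l F x - \sum_(k < N) taylor_term k (wirtinger l F) x)
      <= C * `|x| ^+ N.
  move=> l; apply: IH.
  by exists U; split=> //; exact: csmooth_wirtinger.
have /nbhs_normP[e /= e0 HU] : \forall x \near (0 : E), U x /\ forall l,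
    normc (wirtinger l F x - \sum_(k < N) taylor_term k (wirtinger l F) x)
      <= C l * `|x| ^+ N.
  by apply: filterI; [exact: open_nbhs_nbhs|exact: near_forall HC].
pose D := \sum_l 2 * `|C l|.
pose P x := \sum_(k < N.+1) taylor_term k F x.
have sP : csmooth_on U P by apply: csmooth_sum => // k; exact: csmooth_taylor_term.
pose Q x := F x - P x.
have sQ : csmooth_on U Q.
  apply: (csmooth_ext oU (F := fun x => F x + -1 * P x)).
    by move=> y _; rewrite mulN1r.
  by apply: csmoothD => //; apply: csmoothM => //; exact: csmooth_cst.
have Q0 : Q 0 = 0.
  rewrite /Q /P big_ord_recl big1 ?addr0 ?subrr// => k _.
  have -> : taylor_term (lift ord0 k) F 0 = taylor_term k.+1 F ((0 : R) *: (0 : E)).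
    by rewrite scale0r.
  by rewrite taylor_termZ expr0n mul0r.
have dQ x s : `|x| < e -> 0 <= s <= 1 ->
    U (s *: x) /\ normc (cderive x Q (s *: x)) <= D * `|x| ^+ N.+1.
  move=> xe /andP[s0 s1].
  have sxx : `|s *: x| <= `|x| by rewrite normrZ ger0_norm// ler_piMl.
  have [Us Hs] : U (s *: x) /\ forall l, normc (wirtinger l F (s *: x) -
      \sum_(k < N) taylor_term k (wirtinger l F) (s *: x)) <= C l * `|s *: x| ^+ N.
    by apply: HU; rewrite /ball_/= sub0r normrN (le_lt_trans sxx).
  split=> //.
  have -> : cderive x Q (s *: x) = \sum_l letter l x * (wirtinger l F (s *: x) -
      \sum_(k < N) taylor_term k (wirtinger l F) (s *: x)).
    have cdF := csmooth_diff sF Us.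
    have cdP := csmooth_diff sP Us.
    have QE : Q = (fun y => F y + -1 * P y) by apply/funext => y; rewrite mulN1r.
    rewrite QE (cderiveD x cdF (cdifferentiableZ (-1) cdP)).
    rewrite (cderiveZ (-1) x cdP) (cderive_letter x cdF) mulN1r.
    under [RHS]eq_bigr do rewrite mulrBr.
    rewrite sumrB; congr (_ - _).
    rewrite cderive_sum; last by move=> k; exact: csmooth_diff (csmooth_taylor_term _ _ oU) Us.
    rewrite big_ord_recl cderive_cst add0r.
    under eq_bigr => k _ do rewrite cderive_taylor_term.
    by rewrite exchange_big; apply: eq_bigr => l _; rewrite mulr_sumr.
  rewrite (le_trans (normc_sum _ _ _))// mulr_suml ler_sum// => l _.
  rewrite normcM exprS mulrACA ler_pM ?normc_ge0 ?letter_norm//.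
  apply: le_trans (Hs l) _.
  apply: (@le_trans _ _ (`|C l| * `|s *: x| ^+ N)).
    by rewrite ler_wpM2r ?exprn_ge0// ler_norm.
  by rewrite ler_wpM2l// lerXn2r ?nnegrE.
exists (2 * D); apply/nbhs_normP; exists e => //= x; rewrite /ball_/= sub0r normrN => xe.
have bound (f : E -> R) : f 0 = 0 -> smooth_on U f ->
    (forall s, 0 <= s <= 1 -> `|'D_x f (s *: x)| <= D * `|x| ^+ N.+1) ->
    `|f x| <= D * `|x| ^+ N.+1.
  move=> f0 sf Df; have [|s s01] := @MVT_line _ _ f 0 x 1 ler01.
    by move=> s s01; rewrite add0r; apply: (sf [::]); case: (dQ x s xe s01).
  by rewrite !add0r scale1r f0 subr0 mul1r => ->; exact: Df.
have [sr si] := sQ; rewrite (le_trans (normc_ReIm _))//.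
rewrite -mulrA mulr2n mulrDl mul1r lerD//.
  apply: (bound (fun y => complex.Re (Q y))) => //; first by rewrite Q0.
  move=> s s01; have [_] := dQ x s xe s01; apply: le_trans.
  exact: (normc_Re (cderive x Q (s *: x))).
apply: (bound (fun y => complex.Im (Q y))) => //; first by rewrite Q0.
move=> s s01; have [_] := dQ x s xe s01; apply: le_trans.
exact: (normc_Im (cderive x Q (s *: x))).
Qed.

End Taylor.

(** * Real coordinates and multi-indices *)

Section RealComplex.
Variables (R : realType) (n : nat).
Local Notation E := ('rV[R]_n * 'rV[R]_n)%type.

Lemma of_realK : cancel (@of_real R n) (@to_real R n).
Proof.
case=> x y; rewrite /to_real; congr (_, _); apply/rowP => j.
   by rewrite !mxE.
by rewrite !mxE.
Qed.

Lemma to_realK : cancel (@to_real R n) (@of_real R n).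
Proof.
move=> z; apply/rowP => j; rewrite !mxE /=.
by case: (z 0 j).
Qed.

Lemma to_real0 : to_real (0 : 'rV[R[i]]_n) = 0.
Proof. by congr (_, _); apply/rowP => j; rewrite !mxE. Qed.

Lemma of_realE (x : E) j : of_real x 0 j = letter (false, j) x.
Proof. by rewrite mxE. Qed.

Lemma wirtinger_dz j (f : 'rV[R[i]]_n -> R[i]) :
  dz j f \o @of_real R n = wirtinger (false, j) (f \o @of_real R n).
Proof.
by apply/funext => x; rewrite /= /dz /wirtinger /cpartial /rpartial of_realK mulNr.
Qed.

Lemma wirtinger_dzbar j (f : 'rV[R[i]]_n -> R[i]) :
  dzbar j f \o @of_real R n = wirtinger (true, j) (f \o @of_real R n).
Proof.
by apply/funext => x; rewrite /= /dzbar /wirtinger /cpartial /rpartial of_realK.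
Qed.

End RealComplex.

Section Multiindex.
Variable n : nat.
Local Notation L := (bool * 'I_n)%type.
Local Notation mi := {ffun 'I_n -> nat}.
Implicit Types (ab : mi * mi) (l : L).

Definition mult l ab : nat := if l.1 then ab.2 l.2 else ab.1 l.2.
Definition mdeg ab : nat := \sum_j (ab.1 j + ab.2 j).
Definition mfact ab : nat := \prod_j ((ab.1 j)`! * (ab.2 j)`!).
Definition mincr l ab : mi * mi :=
  ([ffun j => ab.1 j + (l == (false, j))]%N, [ffun j => ab.2 j + (l == (true, j))]%N).
(* The derivations applied by taylor_coef, from the outermost to the innermost. *)
Definition mword ab : seq L :=
  flatten [seq nseq (ab.1 j) (false, j) ++ nseq (ab.2 j) (true, j) | j <- enum 'I_n].

Lemma mult_ext ab ab' : (forall l, mult l ab = mult l ab') -> ab = ab'.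
Proof.
case: ab ab' => a b [a' b'] H; congr (_, _); apply/ffunP => j.
  exact: (H (false, j)).
exact: (H (true, j)).
Qed.

Lemma mult_mincr l m ab : mult m (mincr l ab) = (mult m ab + (l == m))%N.
Proof. by case: m => [[] j]; rewrite /mult /mincr /= ffunE. Qed.

Lemma sum_mult ab : (\sum_l mult l ab)%N = mdeg ab.
Proof.
rewrite -(pair_bigA _ (fun b j => mult (b, j) ab))/= big_bool/= -big_split/=.
by apply: eq_bigr => j _; rewrite addnC.
Qed.

Lemma prod_mult ab : (\prod_l (mult l ab)`!)%N = mfact ab.
Proof.
rewrite -(pair_bigA _ (fun b j => (mult (b, j) ab)`!))/= big_bool/= -big_split/=.
by apply: eq_bigr => j _; rewrite mulnC.
Qed.

Lemma mdeg_mincr l ab : mdeg (mincr l ab) = (mdeg ab).+1.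
Proof.
rewrite -!sum_mult; under eq_bigr do rewrite mult_mincr.
have one : (\sum_m (l == m : nat) = 1)%N.
  by rewrite (bigD1 l)//= eqxx big1// => m ml; rewrite eq_sym (negbTE ml).
by rewrite big_split/= one addn1.
Qed.

Lemma mfact_mincr l ab : mfact (mincr l ab) = ((mult l ab).+1 * mfact ab)%N.
Proof.
rewrite -!prod_mult (bigD1 l)//= [in RHS](bigD1 l)//= mult_mincr eqxx addn1.
rewrite factS mulnA; congr (_ * _)%N; apply: eq_bigr => m ml.
by rewrite mult_mincr eq_sym (negbTE ml) addn0.
Qed.

Lemma mfact_gt0 ab : (0 < mfact ab)%N.
Proof. by rewrite prodn_gt0// => j; rewrite muln_gt0 !fact_gt0. Qed.

Lemma count_mword l ab : count_mem l (mword ab) = mult l ab.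
Proof.
rewrite /mword count_flatten -map_comp sumnE big_map big_enum/=.
rewrite (eq_bigr (fun j => ((l == (false, j)) * ab.1 j + (l == (true, j)) * ab.2 j)%N)); last first.
  by move=> j _; rewrite count_cat !count_nseq/= ![_ == l]eq_sym.
case: l => b j; rewrite (bigD1 j)//= big1 ?addn0.
  by rewrite /mult !xpair_eqE eqxx; case: b; rewrite !andbT /= ?mul0n ?mul1n ?addn0.
by move=> i ij; rewrite !xpair_eqE [j == i]eq_sym (negbTE ij) !andbF.
Qed.

Lemma perm_mword l ab : perm_eq (rcons (mword ab) l) (mword (mincr l ab)).
Proof.
apply/allP => m _; apply/eqP; rewrite -cats1 count_cat !count_mword mult_mincr.
by rewrite /= addn0.
Qed.

Lemma mdegS_mincr k ab l : (0 < mult l ab)%N -> mdeg ab = k.+1 ->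
  exists2 ab', mdeg ab' = k & mincr l ab' = ab.
Proof.
move=> l0 dk; pose ab' : mi * mi :=
  ([ffun j => ab.1 j - (l == (false, j))]%N, [ffun j => ab.2 j - (l == (true, j))]%N).
have E : mincr l ab' = ab.
  apply: mult_ext => m; rewrite mult_mincr.
  have -> : mult m ab' = (mult m ab - (l == m))%N.
    by case: m => [[] j]; rewrite /mult /ab' /= ffunE.
  by rewrite subnK//; case: eqP => // <-.
by exists ab' => //; apply/eqP; rewrite -eqSS -(mdeg_mincr l) E dk.
Qed.

Lemma mincr_inj l : injective (mincr l).
Proof.
move=> ab ab' E; apply: mult_ext => m.
by have := congr1 (mult m) E; rewrite !mult_mincr => /addIn.
Qed.

Lemma finite_mdeg_lt N : finite_set [set ab | (mdeg ab < N)%N].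
Proof.
case: N => [|N].
  by rewrite (_ : [set _ | _] = set0)//; apply/seteqP; split.
pose T := {ffun 'I_n -> 'I_N.+1}.
pose h (fg : T * T) : mi * mi := ([ffun j => val (fg.1 j)], [ffun j => val (fg.2 j)]).
apply: (@sub_finite_set _ _ (h @` setT)); last exact/finite_image/finite_finset.
move=> [a b] /= dN.
have ab j : (a j < N.+1)%N /\ (b j < N.+1)%N.
  have : (a j + b j <= mdeg (a, b))%N by rewrite /mdeg (bigD1 j)//= leq_addr.
  by move=> H; split; apply: leq_ltn_trans dN; apply: leq_trans H;
    rewrite ?leq_addr ?leq_addl.
exists ([ffun j => inord (a j)], [ffun j => inord (b j)]) => //.
by congr (_, _); apply/ffunP => j; rewrite !ffunE /= inordK//; case: (ab j).
Qed.

End Multiindex.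

(** * Taylor coefficients *)

Section Coefficients.
Variables (R : realType) (n : nat).
Local Notation E := ('rV[R]_n * 'rV[R]_n)%type.
Local Notation L := (bool * 'I_n)%type.
Local Notation mi := {ffun 'I_n -> nat}.
Implicit Types (U : set E) (F G : E -> R[i]) (x : E) (l : L) (ab : mi * mi).

Definition wderive (w : seq L) F : E -> R[i] := foldr (@wirtinger R n) F w.

Lemma csmooth_wderive U w F : open U -> csmooth_on U F ->
  csmooth_on U (wderive w F).
Proof. by move=> oU sF; elim: w => //= l w IH; exact: csmooth_wirtinger. Qed.

Lemma wderive_ext U w F G : open U -> (forall y, U y -> F y = G y) ->
  forall x, U x -> wderive w F x = wderive w G x.
Proof.
by move=> oU FG; elim: w => //= l w IH x Ux; exact: wirtinger_ext IH Ux.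
Qed.

Lemma wderive_move U F w1 l w2 : open U -> csmooth_on U F -> forall x, U x ->
  wderive (w1 ++ l :: w2) F x = wderive (l :: w1 ++ w2) F x.
Proof.
move=> oU sF; elim: w1 => // m w1 IH x Ux.
rewrite [LHS](_ : _ = wirtinger m (wderive (l :: w1 ++ w2) F) x); last first.
  exact: (wirtinger_ext m oU IH Ux).
exact: (wirtinger_comm m l oU (csmooth_wderive (w1 ++ w2) oU sF) Ux).
Qed.

Lemma wderive_perm U F w w' : open U -> csmooth_on U F -> perm_eq w w' ->
  forall x, U x -> wderive w F x = wderive w' F x.
Proof.
move=> oU sF; elim: w w' => [|l w IH] w'.
  by move=> /perm_size/= /esym/size0nil ->.
move=> pw x Ux; have /splitPr lw' : l \in w' by rewrite -(perm_mem pw) mem_head.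
case: lw' pw => w1 w2; rewrite perm_sym (perm_catCA w1 [:: l] w2) perm_cons.
rewrite perm_sym => pw; rewrite (wderive_move w1 l w2 oU sF Ux).
exact: (wirtinger_ext l oU (IH _ pw) Ux).
Qed.

Definition coef F ab : R[i] := wderive (mword ab) F 0 / (mfact ab)%:R.

Lemma taylor_coefE (f : 'rV[R[i]]_n -> R[i]) ab :
  taylor_coef f ab.1 ab.2 = coef (f \o @of_real R n) ab.
Proof.
rewrite /taylor_coef /coef /mfact; congr (_ / _).
have iterE (op : ('rV[R[i]]_n -> R[i]) -> 'rV[R[i]]_n -> R[i]) l k g :
    (forall g, op g \o @of_real R n = wirtinger l (g \o @of_real R n)) ->
    iter k op g \o @of_real R n = wderive (nseq k l) (g \o @of_real R n).
  by move=> opE; elim: k => //= k IH; rewrite opE IH.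
set g := foldr _ _ _; transitivity ((g \o @of_real R n) 0).
  by rewrite /= -(to_realK 0) to_real0.
congr (_ 0); rewrite /g /mword; elim: (enum 'I_n) => //= j s IH.
rewrite /wderive !foldr_cat; rewrite [LHS](iterE _ (false, j)); last exact: wirtinger_dz.
by rewrite [X in foldr _ X _ = _](iterE _ (true, j)) ?IH//; exact: wirtinger_dzbar.
Qed.

Lemma coef_wirtinger F l ab : csmooth0 F ->
  coef (wirtinger l F) ab = (mult l ab).+1%:R * coef F (mincr l ab).
Proof.
move=> [U [oU U0 sF]]; rewrite /coef mfact_mincr natrM.
rewrite -(wderive_perm oU sF (perm_mword l ab) U0) /wderive foldr_rcons.
have m0 : (mfact ab)%:R != 0 :> R[i] by rewrite pnatr_eq0 -lt0n mfact_gt0.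
have l0 : (mult l ab).+1%:R != 0 :> R[i] by rewrite pnatr_eq0.
by rewrite invfM [RHS]mulrCA; congr (_ * _); rewrite mulrA divff// mul1r.
Qed.

Definition monomial (z : 'I_n -> R[i]) ab : R[i] :=
  \prod_j (z j ^+ ab.1 j * ((z j)^*)%C ^+ ab.2 j).

Lemma monomial_mincr (z : 'I_n -> R[i]) l ab :
  monomial z (mincr l ab) = (if l.1 then ((z l.2)^*)%C else z l.2) * monomial z ab.
Proof.
rewrite /monomial (bigD1 l.2)//= [in RHS](bigD1 l.2)//= mulrA; congr (_ * _).
  case: l => [[] j]; rewrite /= !ffunE !xpair_eqE /= ?eqxx ?addn0 ?addn1.
    by rewrite exprS mulrCA.
  by rewrite exprS mulrA.
apply: eq_bigr => j jl; rewrite !ffunE.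
by case: l jl => b i /= ji; rewrite !xpair_eqE [i == j]eq_sym (negbTE ji) !andbF !addn0.
Qed.

Lemma monomial0 (z : 'I_n -> R[i]) ab : mdeg ab = 0%N -> monomial z ab = 1.
Proof.
move=> d0; rewrite /monomial big1// => j _.
have /eqP : (ab.1 j + ab.2 j)%N = 0%N.
  by apply/eqP; rewrite -leqn0 -d0 /mdeg (bigD1 j)//= leq_addr.
by rewrite addn_eq0 => /andP[/eqP -> /eqP ->]; rewrite !expr0 mulr1.
Qed.

Definition zcoord x (j : 'I_n) : R[i] := letter (false, j) x.

Lemma finite_mdeg k : finite_set [set ab : mi * mi | mdeg ab = k].
Proof. by apply: sub_finite_set (@finite_mdeg_lt n k.+1) => ab /= ->. Qed.

Lemma reindex_mincr (f : mi * mi -> R[i]) l k :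
  (forall ab, mult l ab = 0%N -> f ab = 0) ->
  \sum_(ab \in [set ab | mdeg ab = k]) f (mincr l ab) =
  \sum_(ab \in [set ab | mdeg ab = k.+1]) f ab.
Proof.
move=> f0; rewrite -(@reindex_fsbig _ _ _ _ _ (mincr l) _
  [set ab | mdeg ab = k.+1 /\ (0 < mult l ab)%N]).
  apply: fsbig_widen => [ab []//|ab [/= dk /not_andP[//|/negP]]].
  by rewrite -leqNgt leqn0 => /eqP/f0.
split.
- by move=> ab /= dk; rewrite mdeg_mincr dk mult_mincr eqxx addn1.
- by move=> ab ab' _ _; exact: mincr_inj.
- by move=> ab [dk l0]; have [ab' d' <-] := mdegS_mincr l0 dk; exists ab'.
Qed.

Lemma taylor_termE k F x : csmooth0 F -> taylor_term k F x =
  \sum_(ab \in [set ab | mdeg ab = k]) coef F ab * monomial (zcoord x) ab.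
Proof.
elim: k F => [|k IH] F sF.
  pose o : mi * mi := ([ffun=> 0%N], [ffun=> 0%N]).
  have od : mdeg o = 0%N by rewrite /mdeg big1// => j _; rewrite !ffunE.
  have -> : [set ab : mi * mi | mdeg ab = 0%N] = [set o].
    apply/seteqP; split => [ab /= d0|ab ->//].
    apply: mult_ext => l; transitivity 0%N.
      by apply/eqP; rewrite -leqn0 -d0 -sum_mult (bigD1 l)//= leq_addr.
    by case: l => [[] j]; rewrite /mult /= ffunE.
  rewrite fsbig_set1 monomial0// mulr1 /coef.
  have -> : mword o = [::].
    apply/eqP; rewrite -size_eq0 -leqn0 leqNgt; apply/negP => s0.
    have [l lo] : exists l, l \in mword o.
      by case: (mword o) s0 => // l s _; exists l; rewrite mem_head.
    move: lo; rewrite -has_pred1 has_count count_mword.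
    by case: l => [[] j]; rewrite /mult /= ffunE.
  have -> : mfact o = 1%N by rewrite /mfact big1// => j _; rewrite !ffunE.
  by rewrite divr1.
pose f l ab := (mult l ab)%:R * (coef F ab * monomial (zcoord x) ab).
have lE l : (if l.1 then ((zcoord x l.2)^*)%C else zcoord x l.2) = letter l x.
  by case: l => [[] j].
have key l : letter l x * taylor_term k (wirtinger l F) x =
    \sum_(ab \in [set ab | mdeg ab = k.+1]) f l ab.
  rewrite -(@reindex_mincr (f l) l); last by rewrite /f => ab ->; rewrite mul0r.
  rewrite (IH _ (csmooth0_wirtinger l sF)) mulr_fsumr; apply: eq_fsbigr => ab _.
  rewrite coef_wirtinger// /f mult_mincr eqxx addn1 monomial_mincr lE.
  by rewrite mulrCA -!mulrA; congr (_ * _); rewrite mulrCA.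
have keyf l : letter l x * taylor_term k (wirtinger l F) x =
    \sum_(ab <- finmap.enum_fset (fset_set [set ab : mi * mi | mdeg ab = k.+1])) f l ab.
  by rewrite key fsbig_finite//; exact: finite_mdeg.
rewrite /= (eq_bigr _ (fun l _ => keyf l)).
rewrite exchange_big/= fsbig_finite; last exact: finite_mdeg.
rewrite mulr_sumr big_seq [RHS]big_seq; apply: eq_bigr => ab.
rewrite in_fset_set; last exact: finite_mdeg.
move=> /set_mem /= dk; rewrite /f -mulr_suml -natr_sum sum_mult dk.
by rewrite mulKf// pnatr_eq0.
Qed.

Lemma taylor_multiindex N F : csmooth0 F -> vanishes N (fun x => F x -
  \sum_(ab \in [set ab | (mdeg ab < N)%N]) coef F ab * monomial (zcoord x) ab).
Proof.
move=> sF; apply: vanishes_near (taylor_expansion N sF); apply: filterE => x.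
congr (_ - _); elim: N => [|N IH].
  by rewrite big_ord0 (_ : [set ab | _] = set0) ?fsbig_set0//; apply/seteqP; split.
rewrite big_ord_recr/= IH taylor_termE// -fsbigU0.
- apply: eq_fsbigl; apply/seteqP; split=> ab /= => [[/ltnW//|->//]|].
  by rewrite ltnS leq_eqVlt => /orP[/eqP|]; [right|left].
- exact: finite_mdeg_lt.
- exact: finite_mdeg.
- by move=> ab [/= + dN]; rewrite dN ltnn.
Qed.

End Coefficients.

(** * Functions of one complex variable *)

Section VanishingTerms.
Variables (R : realType) (n : nat).
Local Notation E := ('rV[R]_n * 'rV[R]_n)%type.

Lemma taylor_term_eq0 N (F : E -> R[i]) : csmooth0 F -> vanishes N F ->
  forall k x, (k < N)%N -> taylor_term k F x = 0.
Proof.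
move=> sF vF.
have : vanishes N (fun x => \sum_(k < N) taylor_term k F x).
  apply: vanishes_near (vanishesB vF (taylor_expansion N sF)).
  by apply: filterE => x; rewrite opprB addrC subrK.
elim: N {vF} => [|N IH] // vS.
have vN : forall k x, (k < N)%N -> taylor_term k F x = 0.
  apply: IH; have vT := vanishes_taylor_term N F.
  apply: vanishes_near (vanishesB (vanishesW (leqnSn N) vS) vT).
  by apply: filterE => x; rewrite big_ord_recr/= addrK.
have t0 : forall x, taylor_term N F x = 0.
  apply: vanishes_homogeneous; first exact: taylor_termZ.
  apply: vanishes_near vS; apply: filterE => x.
  by rewrite big_ord_recr/= big1 ?add0r// => k _; exact: vN.
by move=> k x; rewrite ltnS leq_eqVlt => /orP[/eqP ->|]; [exact: t0|exact: vN].
Qed.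

Lemma wderive0 w (x : E) : wderive w (fun=> 0) x = 0.
Proof.
suff -> : wderive w (fun=> 0) = (fun=> 0) :> (E -> R[i]) by [].
elim: w => //= l w ->; apply/funext => y.
by rewrite /wirtinger !cderive_cst mulr0 addr0 mulr0.
Qed.

Lemma coef_wirtinger0 (F : E -> R[i]) l ab : csmooth0 F ->
  (\forall x \near (0 : E), wirtinger l F x = 0) -> (0 < mult l ab)%N ->
  coef F ab = 0.
Proof.
move=> sF /near_open[V [oV V0 VF]] l0.
have dab : mdeg ab = (mdeg ab).-1.+1.
  by rewrite prednK// (leq_trans l0)// -sum_mult (bigD1 l)//= leq_addr.
have [ab' _ <-] := mdegS_mincr l0 dab.
have := coef_wirtinger l ab' sF; rewrite {1}/coef.
rewrite (@wderive_ext _ _ V _ _ (fun=> 0))// wderive0 mul0r => /esym/eqP.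
by rewrite mulf_eq0 pnatr_eq0/= => /eqP.
Qed.

End VanishingTerms.

Section OneVariable.
Variable R : realType.
Local Notation E := ('rV[R]_1 * 'rV[R]_1)%type.
Local Notation mi := {ffun 'I_1 -> nat}.
Implicit Types (h : R[i] -> R[i]) (ab : mi * mi) (x : E).

Definition mi1 (a b : nat) : mi * mi := ([ffun=> a], [ffun=> b]).

Lemma mi1E ab : ab = mi1 (ab.1 0) (ab.2 0).
Proof.
by case: ab => a b; congr (_, _); apply/ffunP => j; rewrite ffunE /= (ord1 j).
Qed.

Lemma mdeg_mi1 a b : mdeg (mi1 a b) = (a + b)%N.
Proof. by rewrite /mdeg big_ord1 !ffunE. Qed.

Lemma monomial_mi1 (z : 'I_1 -> R[i]) a b :
  monomial z (mi1 a b) = z 0 ^+ a * ((z 0)^*)%C ^+ b.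
Proof. by rewrite /monomial big_ord1 !ffunE. Qed.

Lemma binary_form_eq0 k (c : nat -> R[i]) :
  (forall t : R[i], \sum_(i < k.+1) c i * (t ^+ i * (t^*)%C ^+ (k - i)) = 0) ->
  forall i, (i <= k)%N -> c i = 0.
Proof.
move=> c0; pose p := \poly_(i < k.+1) c i.
pose t (y : nat) : R[i] := 1 +i* y%:R.
have tJ y : (t y)^*%C != 0 by rewrite eq_complex /= oner_eq0.
pose rs := [seq t y / (t y)^*%C | y <- iota 0 k.+1].
have urs : uniq rs.
  rewrite map_inj_uniq ?iota_uniq// => y y' /eqP.
  rewrite eqr_div// => /eqP/(congr1 (@complex.Im R)) /= H.
  apply/eqP; rewrite -(eqr_nat R); apply/eqP; lra.
have rrs : all (root p) rs.
  apply/allP => _ /mapP[y _ ->]; apply/eqP; rewrite horner_poly.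
  have tk : ((t y)^*%C) ^+ k != 0 by rewrite expf_neq0.
  apply: (mulIf tk); rewrite mul0r -[RHS](c0 (t y)) mulr_suml.
  apply: eq_bigr => i _; rewrite expr_div_n -!mulrA; congr (_ * (_ * _)).
  have -> : ((t y)^*%C) ^+ k = ((t y)^*%C) ^+ i * ((t y)^*%C) ^+ (k - i).
    by rewrite -exprD subnKC// -ltnS.
  by rewrite mulKf// expf_neq0.
have p0 : p = 0.
  apply: roots_geq_poly_eq0 rrs urs _.
  by rewrite size_map size_iota size_poly.
move=> i ik; have := congr1 (fun q : {poly R[i]} => q`_i) p0.
by rewrite coef_poly coef0 ltnS ik.
Qed.

Definition realify h : E -> R[i] := onC1 h \o @of_real R 1.

Lemma zcoord_to_real (t : R[i]) : zcoord (to_real (const_mx t : 'rV_1)) 0 = t.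
Proof. by rewrite /zcoord -of_realE to_realK mxE. Qed.

Lemma vanishes_coef h d : csmooth0 (realify h) ->
  vanishes d (realify h) <->
  (forall a b, (a + b < d)%N -> coef (realify h) (mi1 a b) = 0).
Proof.
move=> sh; split=> [vh a b abd|c0].
  set k := (a + b)%N in abd *.
  have -> : b = (k - a)%N by rewrite /k addKn.
  have : (a <= k)%N by rewrite leq_addr.
  apply: (binary_form_eq0 (c := fun a => coef (realify h) (mi1 a (k - a)))) => t.
  rewrite -[RHS](taylor_term_eq0 sh vh (to_real (const_mx t)) abd) taylor_termE//.
  rewrite (fsbig_ord _ _ (fun i => coef (realify h) (mi1 i (k - i)) *
    (t ^+ i * (t^*)%C ^+ (k - i)))).
  rewrite (@reindex_fsbig _ _ _ _ _ (fun i => mi1 i (k - i)) `I_k.+1).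
    by apply: eq_fsbigr => i _; rewrite monomial_mi1 zcoord_to_real.
  split=> [i /= ik|i j _ _ []|[a' b'] /= dk].
  - by rewrite mdeg_mi1 subnKC.
  - by move=> /ffunP/(_ 0); rewrite !ffunE.
  - have Eab := mi1E (a', b'); rewrite /= in Eab; rewrite Eab mdeg_mi1 in dk.
    by exists (a' 0); rewrite /= ?ltnS -dk ?leq_addr ?addKn.
apply: vanishes_near (taylor_multiindex d sh); apply: filterE => x.
rewrite fsbig1 ?subr0// => ab /= abd.
by rewrite (mi1E ab) c0 ?mul0r// -mdeg_mi1 -mi1E.
Qed.

Lemma orderE h : order h = ereal_inf [set d%:R%:E | d in [set d : nat |
  exists a b : nat, d = (a + b)%N /\ coef (realify h) (mi1 a b) <> 0]].
Proof.
rewrite /order; congr (ereal_inf (_ @` _)); apply/funext => d /=.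
by apply/propext; split=> -[a [b [-> H]]]; exists a, b; split=> //;
  move: H; rewrite (taylor_coefE (onC1 h) (mi1 a b)).
Qed.

Lemma order_ge d h : csmooth0 (realify h) ->
  ((d%:R)%:E <= order h)%E <-> vanishes d (realify h).
Proof.
move=> sh; rewrite vanishes_coef// orderE; split=> [dh a b abd|c0].
  apply: contrapT => c0; have := ereal_inf_lbound; rewrite /lbound /=.
  move=> /(_ _ _ (a + b)%:R%:E) H.
  have : (d%:R%:E <= (a + b)%:R%:E :> \bar R)%E.
    by apply: le_trans dh _; apply: H; exists (a + b)%N => //; exists a, b.
  by rewrite lee_fin ler_nat leqNgt abd.
apply: le_ereal_inf_tmp => _ [_ [a [b [-> H]]] <-]; rewrite lee_fin ler_nat leqNgt.
by apply/negP => abd; apply: H; exact: c0.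
Qed.

Variant order_spec h : \bar R -> Prop :=
| OrderInfinite : (forall a b, coef (realify h) (mi1 a b) = 0) -> order_spec h +oo%E
| OrderFinite d a b : d = (a + b)%N -> coef (realify h) (mi1 a b) <> 0 ->
    (forall a b, (a + b < d)%N -> coef (realify h) (mi1 a b) = 0) ->
    order_spec h (d%:R%:E).

Lemma orderP h : order_spec h (order h).
Proof.
rewrite orderE; set A := [set d : nat | _].
have [[d0 Ad0]|A0] := pselect (exists d, A d).
  have exA : exists d, `[< A d >] by exists d0; apply/asboolP.
  case: (ex_minnP exA) => d /asboolP[a [b [dab cab]]] dmin.
  have -> : ereal_inf [set d%:R%:E | d in A] = d%:R%:E :> \bar R.
    apply/eqP; rewrite eq_le; apply/andP; split.
      by apply: ereal_inf_lbound; exists d => //; exists a, b.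
    apply: le_ereal_inf_tmp => _ [d' Ad' <-]; rewrite lee_fin ler_nat.
    by apply: dmin; apply/asboolP.
  apply: OrderFinite dab cab _ => a' b' abd; apply: contrapT => c0.
  have /dmin : `[< A (a' + b')%N >] by apply/asboolP; exists a', b'.
  by rewrite leqNgt abd.
rewrite (_ : A = set0) ?image_set0 ?ereal_inf0.
  apply: OrderInfinite => a b; apply: contrapT => c0; apply: A0.
  by exists (a + b)%N, a, b.
by apply/seteqP; split=> // d Ad; apply: A0; exists d.
Qed.

Lemma order_le h1 h2 : csmooth0 (realify h1) -> csmooth0 (realify h2) ->
  (forall d, vanishes d (realify h2) -> vanishes d (realify h1)) ->
  (order h2 <= order h1)%E.
Proof.
move=> s1 s2 H; have := order_ge _ s1; have := order_ge _ s2.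
case: (orderP h1) => [|d1 a1 b1 _ _ _ g2 g1]; first by rewrite leey.
case: (orderP h2) g2 => [_ g2|d2 a2 b2 _ _ _ g2].
  have /g1 : vanishes d1.+1 (realify h1) by apply/H/g2; rewrite leey.
  by rewrite lee_fin ler_nat ltnn.
rewrite lee_fin ler_nat leqNgt; apply/negP => d12.
have /g1 : vanishes d1.+1 (realify h1) by apply/H/g2; rewrite lee_fin ler_nat.
by rewrite lee_fin ler_nat ltnn.
Qed.

Lemma leading_term h d : csmooth0 (realify h) ->
  (\forall x \near (0 : E), wirtinger (true, ord0) (realify h) x = 0) ->
  order h = d%:R%:E ->
  exists2 c : R[i], c != 0 &
    vanishes d.+1 (fun x => realify h x - c * zcoord x 0 ^+ d).
Proof.
move=> sh dbar; case: (orderP h) => // d' a b d'E cab0 c0 [/eqP].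
rewrite eqr_nat => /eqP dd; rewrite {}dd in d'E c0 *.
have cb0 a' b' : (0 < b')%N -> coef (realify h) (mi1 a' b') = 0.
  by move=> b0; apply: (coef_wirtinger0 sh dbar); rewrite /mult /= ffunE.
have b0 : b = 0%N by case: b d'E cab0 => // b' _ []; exact: cb0.
rewrite b0 addn0 in d'E cab0; rewrite -{}d'E in cab0.
exists (coef (realify h) (mi1 d 0)); first exact/eqP.
apply: vanishes_near (taylor_multiindex d.+1 sh); apply: filterE => x.
congr (_ - _); rewrite -(@fsbig_widen _ _ _ _ [set mi1 d 0]).
- by rewrite fsbig_set1 monomial_mi1 expr0 mulr1.
- by move=> _ ->; rewrite /= mdeg_mi1 addn0.
move=> ab [/= + nab]; move: nab; rewrite (mi1E ab) mdeg_mi1 ltnS => nab.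
case: (ab.2 0) nab => [|b'] nab; last by rewrite cb0// mul0r.
rewrite addn0 leq_eqVlt => /orP[/eqP ad|ad]; first by case: nab; rewrite ad.
by rewrite c0 ?addn0 ?mul0r.
Qed.

End OneVariable.

(** * Composition of maps *)

Section Maps.
Variables (R : realType) (m n : nat).
Local Notation Em := ('rV[R]_m * 'rV[R]_m)%type.
Local Notation En := ('rV[R]_n * 'rV[R]_n)%type.
Implicit Types (g : 'rV[R[i]]_m -> 'rV[R[i]]_n).

Lemma smooth_atP k (f : 'rV[R[i]]_k -> R) p : smooth_at f p <->
  exists U, [/\ open U, U (to_real p) & smooth_on U (f \o @of_real R k)].
Proof.
split=> [/near_open[U [oU Up UP]]|[U [oU Up sU]]].
  by exists U; split=> // vs x Ux; exact: UP.
by apply: filterS (open_nbhs_nbhs (conj oU Up)) => x Ux vs; exact: sU.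
Qed.

Lemma csmooth_atP k (f : 'rV[R[i]]_k -> R[i]) p : csmooth_at f p <->
  exists U, [/\ open U, U (to_real p) & csmooth_on U (f \o @of_real R k)].
Proof.
split=> [[/smooth_atP[U [oU Up sU]] /smooth_atP[V [oV Vp sV]]]|[U [oU Up [sr si]]]].
  exists (U `&` V); split=> //; first exact: openI.
  by split=> vs x [Ux Vx]; [exact: sU|exact: sV].
by split; apply/smooth_atP; exists U.
Qed.

Definition real_map g : Em -> En := @to_real R n \o g \o @of_real R m.

Definition real_coord g (l : bool * 'I_n) (x : Em) : R :=
  if l.1 then complex.Im (g (of_real x) 0 l.2) else complex.Re (g (of_real x) 0 l.2).

Definition dir (l : bool * 'I_n) : En := if l.1 then dir_y R l.2 else dir_x R l.2.

Lemma real_mapE g x : real_map g x = \sum_l real_coord g l x *: dir l.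
Proof.
rewrite -(pair_bigA _ (fun b j => real_coord g (b, j) x *: dir (b, j)))/= big_bool/=.
rewrite /real_coord /dir /= (surjective_pairing (_ + _)) !raddfD/= !raddf_sum/=.
rewrite [X in (X + _, _)]big1 ?add0r; last by move=> i _; rewrite scaler0.
rewrite [X in (_, _ + X)]big1 ?addr0; last by move=> i _; rewrite scaler0.
by congr (_, _); rewrite [LHS]row_sum_delta; apply: eq_bigr => j _; rewrite mxE.
Qed.

Definition csmooth_map g q := forall k, csmooth_at (fun z => g z 0 k) q.

Lemma csmooth_mapP g q : csmooth_map g q -> exists U, [/\ open U, U (to_real q) &
  forall l, smooth_on U (real_coord g l)].
Proof.
move=> sg; have nl l : \forall x \near to_real q, forall vs,
    differentiable (iderive vs (real_coord g l)) x.
  by case: l => b j; have [sr si] := sg j; case: b; [exact: si|exact: sr].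
have /near_open[U [oU Uq UP]] := near_forall nl.
by exists U; split=> // l vs x Ux; exact: UP.
Qed.

Lemma differentiable_real_map g q : csmooth_map g q ->
  differentiable (real_map g) (to_real q).
Proof.
move=> /csmooth_mapP[U [oU Uq sU]];
have -> : real_map g = (fun x => \sum_l real_coord g l x *: dir l).
  by apply/funext => x; exact: real_mapE.
by apply: differentiable_comb => l; exact: (sU l [::]).
Qed.

Lemma near_real_map g q (P : En -> Prop) : csmooth_map g q ->
  (\forall y \near to_real (g q), P y) ->
  \forall x \near to_real q, P (real_map g x).
Proof.
move=> sg nP; apply: (differentiable_continuous (differentiable_real_map sg)).
by rewrite /real_map /= to_realK.
Qed.

Lemma comp_neighborhood g q (V : set En) : csmooth_map g q -> open V ->
  V (to_real (g q)) -> exists U, [/\ open U, U (to_real q),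
    forall l, smooth_on U (real_coord g l) & forall x, U x -> V (real_map g x)].
Proof.
move=> sg oV Vq; have [U [oU Uq sU]] := csmooth_mapP sg.
have nV : \forall x \near to_real q, V (real_map g x).
  have nVq : \forall y \near to_real (g q), V y by exact: (open_nbhs_nbhs (conj oV Vq)).
  exact: near_real_map sg nVq.
have [W [oW Wq WP]] := near_open nV.
exists (U `&` W); split=> //; first exact: openI.
  by move=> l vs x [Ux _]; exact: sU.
by move=> x [_ Wx]; exact: WP.
Qed.

Lemma smooth_at_comp g q (f : 'rV[R[i]]_n -> R) : csmooth_map g q ->
  smooth_at f (g q) -> smooth_at (f \o g) q.
Proof.
move=> sg /smooth_atP[V [oV Vq sf]].
have [U [oU Uq sU UV]] := comp_neighborhood sg oV Vq.
apply/smooth_atP; exists U; split=> //; apply/smooth_onP => k.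
have -> : f \o g \o @of_real R m =
    (fun x => (f \o @of_real R n) (\sum_l real_coord g l x *: dir l)).
  by apply/funext => x; rewrite -real_mapE /real_map /= to_realK.
apply: (Ck_comp (U' := V)) => //.
- by move=> x Ux; rewrite -real_mapE; exact: UV.
- by move=> l; have /smooth_onP := sU l; exact.
- by move/smooth_onP: sf; exact.
Qed.

Lemma csmooth_at_comp g q (f : 'rV[R[i]]_n -> R[i]) : csmooth_map g q ->
  csmooth_at f (g q) -> csmooth_at (f \o g) q.
Proof.
by move=> sg [sr si]; split; [exact: (smooth_at_comp sg sr)|exact: (smooth_at_comp sg si)].
Qed.

(* Along a holomorphic function only the z_j-derivatives survive. *)
Lemma cderive_comp g (F : En -> R[i]) v x :
  (forall l, differentiable (real_coord g l) x) ->
  cdifferentiable F (real_map g x) ->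
  (forall j, wirtinger (true, j) F (real_map g x) = 0) ->
  cderive v (F \o real_map g) x = \sum_j
    cderive v (fun y => g (of_real y) 0 j) x * wirtinger (false, j) F (real_map g x).
Proof.
move=> dg dF hF; pose w := \sum_l 'D_v (real_coord g l) x *: dir l.
have DE (f : En -> R) : differentiable f (real_map g x) ->
    'D_v (f \o real_map g) x = 'D_w f (real_map g x).
  move=> df; have gE : real_map g = (fun x => \sum_l real_coord g l x *: dir l).
    by apply/funext => y; exact: real_mapE.
  rewrite gE in df *; rewrite [LHS](derive_comb v dg df) [RHS](deriveE _ df).
  rewrite /w linear_sum; apply: eq_bigr => l _.
  by rewrite linearZ (deriveE _ df).
have -> : cderive v (F \o real_map g) x = cderive w F (real_map g x).
  have [Fr Fi] := dF; exact: (f_equal2 (@Complex R) (DE _ Fr) (DE _ Fi)).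
rewrite (cderive_letter w dF).
rewrite -(pair_bigA _ (fun b j => letter (b, j) w * wirtinger (b, j) F (real_map g x)))/=.
rewrite big_bool/= [X in X + _]big1 ?add0r; last by move=> j _; rewrite hF mulr0.
apply: eq_bigr => j _; congr (_ * _); rewrite /letter /=.
have wE : w = (\row_j 'D_v (real_coord g (false, j)) x, \row_j 'D_v (real_coord g (true, j)) x).
  rewrite /w -(pair_bigA _ (fun b j => 'D_v (real_coord g (b, j)) x *: dir (b, j)))/=.
  rewrite big_bool/= /dir /= (surjective_pairing (_ + _)) !raddfD/= !raddf_sum/=.
  rewrite [X in (X + _, _)]big1 ?add0r; last by move=> i _; rewrite scaler0.
  rewrite [X in (_, _ + X)]big1 ?addr0; last by move=> i _; rewrite scaler0.
  by congr (_, _); rewrite [RHS]row_sum_delta; apply: eq_bigr => i _; rewrite mxE.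
by rewrite wE !mxE.
Qed.

Lemma wirtinger_comp g (F : En -> R[i]) i x :
  (forall l, differentiable (real_coord g l) x) ->
  cdifferentiable F (real_map g x) ->
  (forall j, wirtinger (true, j) F (real_map g x) = 0) ->
  (forall j, wirtinger (true, i) (fun y => g (of_real y) 0 j) x = 0) ->
  wirtinger (true, i) (F \o real_map g) x = 0.
Proof.
move=> dg dF hF hg.
have C v := cderive_comp v dg dF hF.
rewrite [LHS](_ : _ = \sum_j wirtinger (true, i) (fun y => g (of_real y) 0 j) x *
    wirtinger (false, j) F (real_map g x)).
  by rewrite big1// => j _; rewrite hg mul0r.
rewrite [LHS]/wirtinger !C mulr_sumr -big_split/= mulr_sumr; apply: eq_bigr => j _.
by rewrite [in RHS]/wirtinger /= mulrA -mulrDl mulrA.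
Qed.

End Maps.

(** * Comparison of defining functions *)

Lemma differentiable_lipschitz (R : realType) (V W : normedModType R) (f : V -> W) x0 :
  differentiable f x0 ->
  exists C : R, \forall x \near x0, `|f x - f x0| <= C * `|x - x0|.
Proof.
move=> df; have [k k0 Hk] := linear_lipschitz (diff_continuous df).
have /eqaddoP/(_ 1 ltr01) ho := diff_locally df.
exists (1 + k); rewrite (near_shift 0); apply: filterS ho => h /= H.
rewrite subr0 addrK; rewrite -[f (h + x0) - f x0](subrK ('d f x0 h)).
rewrite (le_trans (ler_normD _ _))// mulrDl lerD ?Hk//.
by move: H; rewrite !fctE /= opprD addrA.
Qed.

Section Hypersurfaces.
Variables (R : realType) (V : normedModType R).
Implicit Types (f g : V -> R) (U : set V).

Lemma line_zero f u x (h c : R) : 0 <= h ->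
  (forall s, 0 <= s <= h -> differentiable f (x + s *: u)) ->
  (forall s, 0 <= s <= h -> c <= 'D_u f (x + s *: u)) -> f x <= 0 -> - f x <= h * c ->
  exists2 s, 0 <= s <= h & f (x + s *: u) = 0.
Proof.
move=> h0 df Df fx0 fxh.
have fh : 0 <= f (x + h *: u).
  have [s sh E] := MVT_line h0 df.
  rewrite -[f _](subrK (f x)) E -lerBlDr sub0r (le_trans fxh)//.
  by rewrite ler_wpM2l// Df.
pose F (s : R) := f (x + s *: u).
have cF : {within `[0, h], continuous F}.
  apply: continuous_in_subspaceT => s; rewrite inE/= in_itv/= => sh.
  apply: differentiable_continuous; apply/derivable1_diffP.
  by case: (is_derive_line (diff_derivable (v := u) (df s sh))).
have [|s sh fs] := @IVT R F 0 h 0 h0 cF.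
  by rewrite /F scale0r addr0 ge_min le_max fx0 fh orbT.
by exists s => //; move: sh; rewrite in_itv.
Qed.

(* Moving x along a direction transverse to {f = 0} reaches a zero of f, hence
   of g, at distance at most a multiple of |f x|. *)
Lemma zero_set_domination U f g v p : open U -> U p -> smooth_on U f ->
  smooth_on U g -> (forall x, U x -> f x = 0 -> g x = 0) -> f p = 0 ->
  'D_v f p != 0 -> exists C : R, \forall x \near p, `|g x| <= C * `|f x|.
Proof.
move=> oU Up sf sg fg fp0; wlog Dp : v / 0 < 'D_v f p => [wl Dv0|_].
  have [Dp|Dn] := ltP 0 ('D_v f p); first exact: (wl v).
  have E : 'D_(- v) f p = - 'D_v f p.
    by rewrite !deriveE ?linearN//; exact: (sf [::]).
  apply: (wl (- v)); rewrite E ?oppr_eq0//.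
  by rewrite oppr_gt0 lt_neqAle Dv0.
pose c := 'D_v f p / 2; have c0 : 0 < c by rewrite divr_gt0.
pose K := `|'D_v g p| + 1; have K0 : 0 < K by rewrite ltr_wpDl.
have cf : {for p, continuous ('D_v f)}.
  by apply: differentiable_continuous; exact: (sf [:: v]).
have cg : {for p, continuous ('D_v g)}.
  by apply: differentiable_continuous; exact: (sg [:: v]).
have cfp : {for p, continuous f}.
  by apply: differentiable_continuous; exact: (sf [::]).
have n1 := @cvgr_dist_lt _ _ _ _ _ _ _ cf _ c0.
have n2 := @cvgr_dist_lt _ _ _ _ _ _ _ cg _ ltr01.
have n3 : \forall x \near p, U x by exact: (open_nbhs_nbhs (conj oU Up)).
have /nbhs_normP[d /= d0 Hd] : \forall x \near p, U x /\
    (`|'D_v f p - 'D_v f x| < c /\ `|'D_v g p - 'D_v g x| < 1).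
  by apply: filterI n3 _; exact: filterI (n1 _) (n2 _).
have Dcv : 0 < d / 2 / (`|v| + 1) * c by rewrite mulr_gt0// !divr_gt0// ltr_wpDl.
have n4 := @cvgr_dist_lt _ _ _ _ _ _ _ cfp _ Dcv.
have n5 : \forall x \near p, `|p - x| < d / 2.
  by apply/nbhs_normP; exists (d / 2) => //=; rewrite divr_gt0.
exists (K / c); apply: filterS2 (n4 _) n5 => x fx px.
rewrite fp0 sub0r normrN in fx.
pose h := `|f x| / c; have h0 : 0 <= h by rewrite divr_ge0// ltW.
have hv : h * `|v| < d / 2.
  have : h < d / 2 / (`|v| + 1) by rewrite ltr_pdivrMr.
  rewrite ltr_pdivlMr ?ltr_wpDl//; apply: le_lt_trans.
  by rewrite ler_wpM2l// lerDl.
have near_x (u : V) s : `|u| = `|v| -> 0 <= s <= h -> ball_ Num.Def.normr p d (x + s *: u).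
  move=> uv /andP[s0 sh]; rewrite /ball_/= opprD addrA (le_lt_trans (ler_normD _ _))//.
  rewrite normrN normrZ ger0_norm// uv [ltRHS]splitr ltrD//.
  by apply: le_lt_trans hv; rewrite ler_wpM2r.
have key (u : V) s0 : `|u| = `|v| -> (forall y, U y -> `|'D_u g y| = `|'D_v g y|) ->
    0 <= s0 <= h -> f (x + s0 *: u) = 0 -> `|g x| <= K / c * `|f x|.
  move=> uv Dg s0h fs0; have /andP[s00 s0h'] := s0h.
  have gs0 : g (x + s0 *: u) = 0 by apply: fg fs0; case: (Hd _ (near_x u s0 uv s0h)).
  have s_h s : 0 <= s <= s0 -> 0 <= s <= h.
    by move=> /andP[-> ss]; exact: le_trans ss s0h'.
  have [|s ss0 E] := @MVT_line _ _ g x u s0 s00.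
    by move=> s /s_h/(near_x u s uv)/Hd[Us _]; exact: (sg [::]).
  rewrite -[g x]opprK normrN -[- g x]add0r -gs0 E normrM ger0_norm//.
  have -> : K / c * `|f x| = h * K by rewrite /h; ring.
  have /andP[sa sb] := s_h s ss0; rewrite ler_pM//.
  have [Us [_ Hg]] := Hd _ (near_x u s uv (s_h s ss0)).
  rewrite Dg// /K -[X in `|X|](subrK ('D_v g p)) addrC (le_trans (ler_normD _ _))//.
  by rewrite lerD// distrC ltW.
have [fx0|fx0] := leP (f x) 0.
  have [||||s sh fs] := @line_zero f v x h c h0.
  - by move=> s /(near_x v s erefl)/Hd[Us _]; exact: (sf [::]).
  - move=> s /(near_x v s erefl)/Hd[_ [Hf _]].
    move: Hf; rewrite ltr_distl => /andP[_ Hf].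
    by rewrite /c in Hf *; lra.
  - by [].
  - by rewrite /h divfK ?gt_eqF// ler0_norm.
  by apply: (key v s).
have nvE : `|- v| = `|v| by rewrite normrN.
have [||||s sh fs] := @line_zero (- f) (- v) x h c h0.
- by move=> s /(near_x (- v) s nvE)/Hd[Us _]; apply: differentiableN; exact: (sf [::]).
- move=> s /(near_x (- v) s nvE)/Hd[Us [Hf _]].
  have dfs := sf [::] _ Us; rewrite deriveN; last exact: diff_derivable.
  rewrite deriveE// linearN opprK -deriveE//.
  by move: Hf; rewrite ltr_distl => /andP[_ Hf]; rewrite /c in Hf *; lra.
- by rewrite fctE oppr_le0 ltW.
- by rewrite fctE opprK /h divfK ?gt_eqF// gtr0_norm.
apply: (key (- v) s) => //.
  by move=> y Uy; have dg := sg [::] _ Uy; rewrite !deriveE// linearN normrN.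
by apply/eqP; rewrite -oppr_eq0; apply/eqP.
Qed.

End Hypersurfaces.

Section Transfer.
Variable R : realType.

Lemma zcoordB n (x y : 'rV[R]_n * 'rV[R]_n) j :
  zcoord (x - y) j = zcoord x j - zcoord y j.
Proof. by rewrite /zcoord /letter /= !mxE; apply/eqP; rewrite eq_complex /= !eqxx. Qed.

Lemma zcoord_to_realE n (z : 'rV[R[i]]_n) j : zcoord (to_real z) j = z 0 j.
Proof. by rewrite /zcoord -of_realE to_realK. Qed.

Lemma norm_le_zcoord n (x : 'rV[R]_n * 'rV[R]_n) :
  `|x| <= \sum_j normc (zcoord x j).
Proof.
have s0 : 0 <= \sum_j normc (zcoord x j) by apply: sumr_ge0 => j _; exact: normc_ge0.
have le_j j : normc (zcoord x j) <= \sum_j normc (zcoord x j).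
  by rewrite (bigD1 j)//= lerDl sumr_ge0// => i _; exact: normc_ge0.
rewrite prod_normE ge_max; apply/andP; split; rewrite [leLHS]mx_normrE;
  apply/bigmax_leP; split=> // -[i j] _ /=; rewrite (ord1 i); apply: le_trans (le_j j).
  exact: (normc_Re (zcoord x j)).
exact: (normc_Im (zcoord x j)).
Qed.

Lemma vanishes_norm m n d (g : 'rV[R]_m * 'rV[R]_m -> 'rV[R]_n * 'rV[R]_n) :
  (forall j, vanishes d (fun x => zcoord (g x) j)) ->
  exists2 C : R, 0 <= C & \forall x \near (0 : 'rV[R]_m * 'rV[R]_m), `|g x| <= C * `|x| ^+ d.
Proof.
move=> vg; have /choice[C HC] : forall j, exists C : R,
    \forall x \near (0 : 'rV[R]_m * 'rV[R]_m), normc (zcoord (g x) j) <= C * `|x| ^+ d.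
  exact: vg.
exists (\sum_j `|C j|); first by rewrite sumr_ge0.
apply: filterS (near_forall HC) => x Hx; rewrite (le_trans (norm_le_zcoord _))//.
rewrite mulr_suml ler_sum// => j _; rewrite (le_trans (Hx j))//.
by rewrite ler_wpM2r ?exprn_ge0// ler_norm.
Qed.

Lemma vanishes_map m n k d (h : 'rV[R[i]]_m -> 'rV[R[i]]_n)
    (f : 'rV[R[i]]_n -> 'rV[R[i]]_k) : csmooth_map h 0 -> csmooth_map f (h 0) ->
  (forall j, vanishes d (fun x => h (of_real x) 0 j - h 0 0 j)) ->
  forall i, vanishes d (fun x => f (h (of_real x)) 0 i - f (h 0) 0 i).
Proof.
move=> sh sf vh i.
have [C HC] := differentiable_lipschitz (differentiable_real_map sf).
have := near_real_map sh HC; rewrite to_real0 => HC0.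
have [|D D0 HD] := @vanishes_norm m n d (fun x => real_map h x - to_real (h 0)).
  move=> j; apply: vanishes_near (vh j); apply: filterE => x.
  by rewrite zcoordB /real_map /= !zcoord_to_realE.
exists (2 * (`|C| * D)); apply: filterS2 HC0 HD => x HCx HDx.
have -> : f (h (of_real x)) 0 i - f (h 0) 0 i =
    letter (false, i) (real_map f (real_map h x) - real_map f (to_real (h 0))).
  by rewrite -/(zcoord _ i) zcoordB /real_map /= !to_realK !zcoord_to_realE.
rewrite (le_trans (letter_norm _ _))// -mulrA ler_pM2l//.
rewrite (le_trans HCx)// -mulrA; apply: (@le_trans _ _ (`|C| * `|real_map h x - to_real (h 0)|)).
  by rewrite ler_wpM2r// ler_norm.
by rewrite ler_wpM2l.
Qed.

Lemma csmooth0_at n (f : 'rV[R[i]]_n -> R[i]) :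
  csmooth_at f 0 <-> csmooth0 (f \o @of_real R n).
Proof. by rewrite csmooth_atP to_real0. Qed.

Lemma csmooth_at_real n (r : 'rV[R[i]]_n -> R) p :
  smooth_at r p -> csmooth_at (fun z => (r z)%:C) p.
Proof.
move=> sr; split; first exact: sr.
apply/smooth_atP; exists setT; split=> //; first exact: openT.
by apply/smooth_onP => k; exact: Ck_cst.
Qed.

Variable n : nat.

Lemma gradient_neq0 (r : 'rV[R[i]]_n -> R) p : gradient r p <> 0 ->
  exists v, 'D_v (r \o @of_real R n) (to_real p) != 0.
Proof.
move=> g0; apply: contrapT => /forallNP D0; apply: g0.
by congr (_, _); apply/rowP => j; rewrite !mxE;
  apply/eqP; rewrite -[_ == _]negbK; apply/negP; exact: D0.
Qed.

Lemma defining_domination (M : set 'rV[R[i]]_n) p (r1 r2 : 'rV[R[i]]_n -> R) :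
  M p -> local_defining_function M p r1 -> local_defining_function M p r2 ->
  exists C : R, \forall x \near to_real p,
    `|r2 (of_real x)| <= C * `|r1 (of_real x)|.
Proof.
move=> Mp [/smooth_atP[U1 [oU1 U1p s1]] z1 g1] [/smooth_atP[U2 [oU2 U2p s2]] z2 _].
have [W [oW Wp WP]] := near_open (filterI z1 z2).
have rp : r1 p = 0 by have [[+ _] _] := WP _ Wp; rewrite to_realK; apply.
have /gradient_neq0[v Dv] : gradient r1 p <> 0.
  by have := nbhs_singleton g1; rewrite /= to_realK; apply.
have UUW : forall x, (U1 `&` U2 `&` W) x -> [/\ U1 x, U2 x & W x] by move=> x [[]].
apply: (@zero_set_domination R _ (U1 `&` U2 `&` W) (r1 \o @of_real R n)
  (r2 \o @of_real R n) v (to_real p)) => //.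
- by apply: openI => //; exact: openI.
- by move=> vs x /UUW[Ux _ _]; exact: s1.
- by move=> vs x /UUW[_ Ux _]; exact: s2.
- by move=> x /UUW[_ _ /WP[[_ H1] [H2 _]]] /= /H1/H2.
- by rewrite /= to_realK.
Qed.

Lemma order_defining_le (M : set 'rV[R[i]]_n) p (r1 r2 : 'rV[R[i]]_n -> R)
    (gamma : R[i] -> 'rV[R[i]]_n) : M p ->
  local_defining_function M p r1 -> local_defining_function M p r2 ->
  csmooth_map (onC1 gamma) 0 -> gamma 0 = p ->
  (order (fun t => (r1 (gamma t))%:C) <= order (fun t => (r2 (gamma t))%:C))%E.
Proof.
move=> Mp d1 d2 sg g0; have g0' : onC1 gamma 0 = p by rewrite /onC1 mxE.
have sr r : local_defining_function M p r -> csmooth0 (realify (fun t => (r (gamma t))%:C)).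
  move=> [sr _ _]; apply/csmooth0_at.
  apply: (@csmooth_at_comp _ _ _ (onC1 gamma) 0 (fun z => (r z)%:C)) => //.
  by apply: csmooth_at_real; rewrite g0'.
have [C HC] := defining_domination Mp d1 d2; rewrite -g0' in HC.
have := near_real_map sg HC; rewrite to_real0 => HC0.
apply: order_le; [exact: sr|exact: sr|move=> d].
apply: (@vanishes_le _ _ _ _ _ `|C|) => //; apply: filterS HC0 => x.
rewrite /real_map /= to_realK /realify /= /onC1 => H.
rewrite !expr0n !addr0 !sqrtr_sqr (le_trans H)//.
by rewrite ler_wpM2r// ler_norm.
Qed.

Lemma order_defining (M : set 'rV[R[i]]_n) p (r1 r2 : 'rV[R[i]]_n -> R)
    (gamma : R[i] -> 'rV[R[i]]_n) : M p ->
  local_defining_function M p r1 -> local_defining_function M p r2 ->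
  csmooth_map (onC1 gamma) 0 -> gamma 0 = p ->
  order (fun t => (r1 (gamma t))%:C) = order (fun t => (r2 (gamma t))%:C).
Proof.
move=> Mp d1 d2 sg g0; apply/eqP; rewrite eq_le; apply/andP.
by split; exact: order_defining_le Mp _ _ sg g0.
Qed.

End Transfer.

(** * Newton polyhedra and coordinate axes *)

Section Axes.
Variables (R : realType) (n : nat).
Local Notation E1 := ('rV[R]_1 * 'rV[R]_1)%type.
Local Notation En := ('rV[R]_n * 'rV[R]_n)%type.
Local Notation mi := {ffun 'I_n -> nat}.

Definition axis (j : 'I_n) (t : R[i]) : 'rV[R[i]]_n := t *: delta_mx 0 j.

Definition real_axis (j : 'I_n) (x : E1) : En :=
  (x.1 0 0 *: delta_mx 0 j, x.2 0 0 *: delta_mx 0 j).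

Lemma of_real_axis j x : of_real (real_axis j x) = axis j (of_real x 0 0).
Proof.
apply/rowP => k; rewrite !mxE /=; case: (k == j); rewrite ?mulr1 ?mulr0//.
Qed.

Lemma realify_axis (F : 'rV[R[i]]_n -> R[i]) j :
  realify (F \o axis j) = (F \o @of_real R n) \o real_axis j.
Proof. by apply/funext => x; rewrite /realify /onC1 /= of_real_axis. Qed.

Lemma wirtinger_axis (G : En -> R[i]) b j x :
  wirtinger (b, j) G (real_axis j x) = wirtinger (b, ord0) (G \o real_axis j) x.
Proof.
have DE (f : En -> R) v w : (forall h : R, real_axis j (h *: v + x) = h *: w + real_axis j x) ->
    'D_w f (real_axis j x) = 'D_v (f \o real_axis j) x.
  move=> vw; rewrite /derive; have -> : (fun h : R => h^-1 *: ((f \o shift (real_axis j x)) (h *: w)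
      - f (real_axis j x))) = (fun h : R => h^-1 *: (((f \o real_axis j) \o shift x) (h *: v)
      - (f \o real_axis j) x)); last by [].
  by apply/funext => h; rewrite /shift /= vw.
rewrite /wirtinger /cderive.
have dx (h : R) : real_axis j (h *: dir_x R ord0 + x) = h *: dir_x R j + real_axis j x.
  rewrite /real_axis /dir_x /= !mxE /= mulr1 mulr0 add0r.
  by congr (_, _); rewrite /= ?scaler0 ?add0r ?scalerDl.
have dy (h : R) : real_axis j (h *: dir_y R ord0 + x) = h *: dir_y R j + real_axis j x.
  rewrite /real_axis /dir_y /= !mxE /= mulr1 mulr0 add0r.
  by congr (_, _); rewrite /= ?scaler0 ?add0r ?scalerDl.
by rewrite !(DE _ _ _ dx) !(DE _ _ _ dy).
Qed.

Lemma wderive_axis (G : En -> R[i]) (s : seq bool) j x :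
  wderive [seq (b, j) | b <- s] G (real_axis j x) =
  wderive [seq (b, ord0) | b <- s] (G \o real_axis j) x.
Proof.
elim: s x => [x|b s IH x]; first by [].
have E : wderive [seq (b, j) | b <- s] G \o real_axis j =
    wderive [seq (b, ord0) | b <- s] (G \o real_axis j).
  by apply/funext => y; exact: IH.
etransitivity; first exact: wirtinger_axis.
exact: (congr1 (fun H => wirtinger (b, ord0) H x) E).
Qed.

End Axes.

Section AxisMultiindex.
Variable n : nat.
Local Notation mi := {ffun 'I_n -> nat}.

Definition axis_mi (j : 'I_n) a b : mi * mi :=
  ([ffun i => if i == j then a else 0%N], [ffun i => if i == j then b else 0%N]).

Definition axis_word (a b : nat) : seq bool := nseq a false ++ nseq b true.

Lemma perm_axis_word j a b :
  perm_eq (mword (axis_mi j a b)) [seq (c, j) | c <- axis_word a b].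
Proof.
apply/allP => -[c i] _; apply/eqP; rewrite /= count_mword /mult count_map /axis_word.
rewrite count_cat !count_nseq /= !xpair_eqE [j == i]eq_sym.
by case: c => /=; rewrite ffunE; case: (i == j); rewrite ?muln0 ?mul0n ?mul1n ?addn0.
Qed.

Lemma mfact_axis j a b : mfact (axis_mi j a b) = (a`! * b`!)%N.
Proof.
rewrite /mfact (bigD1 j)//= big1 ?muln1 ?ffunE ?eqxx// => i ij.
by rewrite !ffunE (negbTE ij).
Qed.

End AxisMultiindex.

Lemma axis_mi1 a b : axis_mi ord0 a b = mi1 a b.
Proof. by congr (_, _); apply/ffunP => i; rewrite !ffunE (ord1 i). Qed.

Section NewtonAxes.
Variables (R : realType) (n : nat).
Local Notation mi := {ffun 'I_n -> nat}.
Implicit Types (F : 'rV[R[i]]_n -> R[i]) (j : 'I_n).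

Lemma csmooth_axis j : csmooth_map (onC1 (@axis R n j)) 0.
Proof.
move=> k; apply/csmooth0_at; exists setT; split=> //; first exact: openT.
apply: (csmooth_ext openT (F := fun x => (k == j)%:R * letter (false, ord0) x)).
  by move=> x _; rewrite /onC1 /axis /= !mxE /= mulrC.
by apply: csmoothM; [exact: openT|exact: csmooth_cst|exact: csmooth_letter openT].
Qed.

Lemma axis0 j : @axis R n j 0 = 0.
Proof. exact: scale0r. Qed.

Lemma csmooth_comp_curve F (eta : R[i] -> 'rV[R[i]]_n) : csmooth_map (onC1 eta) 0 ->
  csmooth_at F (eta 0) -> csmooth0 (realify (F \o eta)).
Proof.
move=> se sF; apply/csmooth0_at.
by apply: (csmooth_at_comp (g := onC1 eta)) => //; rewrite /onC1 mxE.
Qed.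

Lemma coef_axis F j a b : csmooth_at F 0 ->
  coef (F \o @of_real R n) (axis_mi j a b) = coef (realify (F \o axis j)) (mi1 a b).
Proof.
move=> sF; have [U [oU U0 sU]] := (csmooth0_at F).1 sF.
have [|V [oV V0 sV]] := csmooth_comp_curve (csmooth_axis j) (F := F).
  by rewrite axis0.
rewrite -axis_mi1 /coef !mfact_axis; congr (_ / _).
rewrite (wderive_perm oU sU (perm_axis_word j a b) U0).
rewrite (wderive_perm oV sV (perm_axis_word ord0 a b) V0).
rewrite realify_axis -wderive_axis; congr (wderive _ _ _).
by rewrite /real_axis /= !mxE !scale0r.
Qed.

Lemma order_ge1 (h : R[i] -> R[i]) : csmooth0 (realify h) -> h 0 = 0 ->
  (1%:E <= order h)%E.
Proof.
move=> sh h0; apply/(order_ge 1 sh); apply: vanishes_near (taylor_expansion 1 sh).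
by apply: filterE => x; rewrite big_ord1 /= /realify /onC1 /= !mxE h0 subr0.
Qed.

Lemma convex_setP (A : set 'rV[R]_n) :
  (forall x y (k : R), 0 < k -> k < 1 -> A x -> A y -> A (k *: x + (1 - k) *: y)) ->
  @convex_set R 'rV[R]_n A.
Proof.
move=> HA; apply/convex_setW => x y /set_mem Ax /set_mem Ay k k0 k1.
by apply/mem_set; exact: HA.
Qed.

Lemma newton_exponent F (ab : mi * mi) : coef (F \o @of_real R n) ab <> 0 ->
  newton_polyhedron F (exponent R ab.1 ab.2).
Proof.
move=> c0; apply: sub_gen_smallest; exists ab.1, ab.2; split=> //.
by rewrite taylor_coefE.
Qed.

Lemma newton_sub F (A : set 'rV[R]_n) :
  (forall x y (k : R), 0 < k -> k < 1 -> A x -> A y -> A (k *: x + (1 - k) *: y)) ->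
  (forall (ab : mi * mi) (xi : 'rV[R]_n), coef (F \o @of_real R n) ab <> 0 ->
     (forall j, exponent R ab.1 ab.2 0 j <= xi 0 j) -> A xi) ->
  newton_polyhedron F `<=` A.
Proof.
move=> /convex_setP cA gA; apply: smallest_sub => // xi [a [b [c0 ge]]].
by apply: (gA (a, b)) => //; move: c0; rewrite (taylor_coefE F (a, b)).
Qed.

Lemma newton_axis F j (x : R) : csmooth_at F 0 ->
  newton_polyhedron F (x *: delta_mx 0 j) -> (order (F \o axis j) <= x%:E)%E.
Proof.
move=> sF Nx; set o := order _.
suff : [set xi : 'rV[R]_n | (forall i, 0 <= xi 0 i) /\
    ((forall i, i != j -> xi 0 i = 0) -> (o <= (xi 0 j)%:E)%E)] (x *: delta_mx 0 j).
  move=> [_]; rewrite !mxE !eqxx mulr1; apply=> i ij.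
  by rewrite !mxE (negbTE ij) andbF mulr0.
apply: newton_sub Nx => [y z k k0 k1 [y0 yj] [z0 zj]|ab xi c0 ge] /=.
  have k1' : 0 < 1 - k by rewrite subr_gt0.
  split=> [i|yz]; first by rewrite !mxE addr_ge0// mulr_ge0 ?(ltW k0) ?(ltW k1') ?y0 ?z0.
  have yz0 i : i != j -> y 0 i = 0 /\ z 0 i = 0.
    have ky := mulr_ge0 (ltW k0) (y0 i); have kz := mulr_ge0 (ltW k1') (z0 i).
    move=> /yz/eqP; rewrite !mxE paddr_eq0//.
    by rewrite !mulf_eq0 (gt_eqF k0) (gt_eqF k1')/= => /andP[/eqP -> /eqP ->].
  have := zj (fun i ij => (yz0 i ij).2); have := yj (fun i ij => (yz0 i ij).1).
  rewrite /o; case: (orderP (F \o axis j)) => [_|d a b _ _ _]; first by rewrite leye_eq.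
  by rewrite !lee_fin !mxE => dy dz; nra.
have xi0 i : 0 <= xi 0 i by apply: le_trans (ge i); rewrite mxE.
split=> // xij.
have abE : ab = axis_mi j (ab.1 j) (ab.2 j).
  have ab0 i : i != j -> ab.1 i = 0%N /\ ab.2 i = 0%N.
    move=> ij; have := ge i; rewrite (xij i ij) mxE -[0]/(0%:R) ler_nat leqn0.
    by rewrite addn_eq0 => /andP[/eqP -> /eqP ->].
  case: ab ab0 {c0 ge} => a b /= ab0; congr (_, _); apply/ffunP => i; rewrite ffunE;
    by case: eqVneq => [->//|/ab0[]].
have := ge j; rewrite mxE -lee_fin; apply: le_trans.
rewrite /o; case: (orderP (F \o axis j)) => [c0'|d a b _ _ dmin].
  by move: c0; rewrite abE coef_axis// c0'.
rewrite lee_fin ler_nat leqNgt; apply/negP => /dmin c0'.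
by move: c0; rewrite abE coef_axis.
Qed.

Lemma newton_axis_order F j d : csmooth_at F 0 ->
  order (F \o axis j) = d%:R%:E -> newton_polyhedron F (d%:R *: delta_mx 0 j).
Proof.
move=> sF; case: (orderP (F \o axis j)) => // d' a b d'E c0 _ [/eqP].
rewrite eqr_nat => /eqP <-; rewrite -coef_axis// in c0.
suff <- : exponent R (axis_mi j a b).1 (axis_mi j a b).2 = d'%:R *: delta_mx 0 j.
  exact: newton_exponent.
apply/rowP => i; rewrite !mxE !ffunE eqxx /= d'E eq_sym.
by case: (j == i); rewrite ?mulr1 ?mulr0.
Qed.

Lemma rhoE F j : csmooth_at F 0 -> F 0 = 0 -> rho F j = order (F \o axis j).
Proof.
move=> sF F0; apply/eqP; rewrite eq_le; apply/andP; split; last first.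
  by apply: le_ereal_inf_tmp => _ [x [x0 Nx] <-]; exact: newton_axis.
have sFj : csmooth0 (realify (F \o axis j)).
  by apply: csmooth_comp_curve; [exact: csmooth_axis|rewrite axis0].
have := order_ge1 sFj; rewrite /= axis0 F0 => /(_ erefl).
have := @newton_axis_order F j; case: (orderP (F \o axis j)) => [|d a b _ _ _ N d1].
  by move=> *; rewrite leey.
apply: ereal_inf_lbound; exists d%:R => //; split; last exact: N.
by rewrite lee_fin in d1; exact: lt_le_trans ltr01 d1.
Qed.

Lemma rho1E F : csmooth_at F 0 -> F 0 = 0 -> (0 < n)%N ->
  rho1 F = \big[maxe/-oo%E]_(j < n) order (F \o axis j).
Proof.
move=> sF F0 n0; rewrite /rho1; case: asboolP => [_|nc].
  by apply: eq_bigr => j _; exact: rhoE.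
have /existsNP[j Nj] := nc; apply/esym/eqP; rewrite -leye_eq.
apply: le_trans (le_bigmax _ _ j); rewrite leye_eq.
have := @newton_axis_order F j; case: (orderP (F \o axis j)) => // d a b _ _ _ N.
by case: Nj; exists d%:R; exact: N.
Qed.

End NewtonAxes.

(** * Leading forms *)

Section LeadingForms.
Variables (R : realType) (m : nat).
Local Notation E := ('rV[R]_m * 'rV[R]_m)%type.
Implicit Types (f g : E -> R[i]).

(* f and g have the same (possibly zero) leading form, of degree k. *)
Definition same_leading k f g :=
  [/\ vanishes k f, vanishes k g & vanishes k.+1 (fun x => f x - g x)].

Lemma same_leading_ext k f g f' g' : (forall x, f x = f' x) ->
  (forall x, g x = g' x) -> same_leading k f g -> same_leading k f' g'.
Proof. by move=> /funext -> /funext ->. Qed.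

Lemma same_leading1 : same_leading 0 (fun=> 1) (fun=> 1).
Proof.
split; [exact: vanishes_cst|exact: vanishes_cst|].
by apply: vanishes_near (vanishes0 _ _ 1); apply: filterE => x; rewrite subrr.
Qed.

Lemma same_leadingM k k' f g f' g' : same_leading k f g -> same_leading k' f' g' ->
  same_leading (k + k') (fun x => f x * f' x) (fun x => g x * g' x).
Proof.
move=> [vf vg vfg] [vf' vg' vfg']; split; [exact: vanishesM|exact: vanishesM|].
have H1 := vanishesM vfg vf'; have H2 := vanishesM vg vfg'.
rewrite addSn in H1; rewrite addnS in H2.
by apply: vanishes_near (vanishesD H1 H2); apply: filterE => x; ring.
Qed.

Lemma same_leadingX k e f g : same_leading k f g ->
  same_leading (k * e) (fun x => f x ^+ e) (fun x => g x ^+ e).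
Proof.
move=> H; elim: e => [|e IH]; first by rewrite muln0; exact: same_leading1.
rewrite mulnS; apply: same_leading_ext (same_leadingM H IH) => x;
  by rewrite exprS.
Qed.

Lemma same_leading_conj k f g : same_leading k f g ->
  same_leading k (fun x => (f x)^*%C) (fun x => (g x)^*%C).
Proof.
move=> [vf vg vfg]; split; [exact: vanishes_conj|exact: vanishes_conj|].
by apply: vanishes_near (vanishes_conj vfg); apply: filterE => x; rewrite rmorphB.
Qed.

Variable n : nat.

Implicit Types (ab : {ffun 'I_n -> nat} * {ffun 'I_n -> nat}).

Definition weight (a : 'I_n -> nat) ab : nat :=
  \sum_j a j * (ab.1 j + ab.2 j).

Lemma same_leading_monomial (a : 'I_n -> nat) (f g : 'I_n -> E -> R[i]) ab :
  (forall j, (0 < ab.1 j + ab.2 j)%N -> same_leading (a j) (f j) (g j)) ->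
  same_leading (weight a ab) (fun x => monomial (f ^~ x) ab) (fun x => monomial (g ^~ x) ab).
Proof.
move=> H; rewrite /weight /monomial.
elim: (index_enum 'I_n) => [|j s IH].
  by rewrite big_nil; apply: same_leading_ext same_leading1 => x; rewrite big_nil.
rewrite big_cons; suff H1 : same_leading (a j * (ab.1 j + ab.2 j))
    (fun x => f j x ^+ ab.1 j * (f j x)^*%C ^+ ab.2 j)
    (fun x => g j x ^+ ab.1 j * (g j x)^*%C ^+ ab.2 j).
  by apply: same_leading_ext (same_leadingM H1 IH) => x; rewrite big_cons.
have [ab0|/H Hj] := posnP (ab.1 j + ab.2 j).
  move/eqP: ab0; rewrite addn_eq0 => /andP[/eqP -> /eqP ->]; rewrite muln0.
  by apply: same_leading_ext same_leading1 => x; rewrite !expr0 mulr1.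
rewrite mulnDr; apply: same_leadingM; first exact: same_leadingX.
by apply: same_leadingX; exact: same_leading_conj.
Qed.

Lemma mdeg_le_weight (a : 'I_n -> nat) ab : (forall j, (0 < a j)%N) ->
  (mdeg ab <= weight a ab)%N.
Proof. by move=> a0; apply: leq_sum => j _; rewrite leq_pmull. Qed.

Lemma weight_ge (a : 'I_n -> nat) ab j : (0 < ab.1 j + ab.2 j)%N ->
  (a j <= weight a ab)%N.
Proof.
by move=> j0; rewrite /weight (bigD1 j)//= (leq_trans _ (leq_addr _ _))// leq_pmulr.
Qed.

Lemma monomial_weighted (a : 'I_n -> nat) (c : 'I_n -> R[i]) ab (s : R) (t : R[i]) :
  monomial (fun j => c j * (s%:C * t) ^+ a j) ab =
  s%:C ^+ weight a ab * monomial (fun j => c j * t ^+ a j) ab.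
Proof.
rewrite /weight expr_sum -big_split/=; apply: eq_bigr => j _.
have -> : c j * (s%:C * t) ^+ a j = s%:C ^+ a j * (c j * t ^+ a j).
  by rewrite exprMn mulrCA.
move: (c j * t ^+ a j) => w.
have -> : ((s%:C ^+ a j * w)^*)%C = s%:C ^+ a j * (w^*)%C.
  by rewrite -(rmorphXn (real_complex R)) [LHS]rmorphM; congr (_ * _); exact: conjc_real.
by rewrite !exprMn -!exprM mulnDr exprD mulrACA.
Qed.

End LeadingForms.

Section Nondegenerate.
Variables (R : realType) (n : nat).
Local Notation E1 := ('rV[R]_1 * 'rV[R]_1)%type.
Local Notation mi := {ffun 'I_n -> nat}.
Implicit Types (F : 'rV[R[i]]_n -> R[i]).

Lemma pairing_exponent (a : mi) (ab : mi * mi) :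
  pairing a (exponent R ab.1 ab.2) = (weight a ab)%:R.
Proof.
by rewrite /pairing natr_sum; apply: eq_bigr => j _; rewrite mxE natrM.
Qed.

Lemma weight_axis (a : mi) j p q : weight a (axis_mi j p q) = (a j * (p + q))%N.
Proof.
rewrite /weight (bigD1 j)//= !ffunE eqxx big1 ?addn0// => i ij.
by rewrite !ffunE (negbTE ij) muln0.
Qed.

Definition face F (a : mi) (l : nat) : set 'rV[R]_n :=
  newton_polyhedron F `&` [set xi | pairing a xi = l%:R].

Lemma face_determined F (a : mi) (ab : mi * mi) : (forall j, (0 < a j)%N) ->
  coef (F \o @of_real R n) ab <> 0 ->
  (forall ab', coef (F \o @of_real R n) ab' <> 0 -> (weight a ab <= weight a ab')%N) ->
  determines F a (face F a (weight a ab)).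
Proof.
move=> a0 c0 lmin; split=> //.
  by exists (exponent R ab.1 ab.2); split; [exact: newton_exponent|exact: pairing_exponent].
exists (weight a ab); split=> //; apply: newton_sub => [x y k k0 k1 lx ly|ab' xi c0' ge] /=.
  rewrite [leRHS](_ : _ = k * pairing a x + (1 - k) * pairing a y).
    have h1 := mulr_ge0 (ltW k0) (_ : 0 <= pairing a x - (weight a ab)%:R).
    have h2 := mulr_ge0 (_ : 0 <= 1 - k) (_ : 0 <= pairing a y - (weight a ab)%:R).
    move: h1 h2; rewrite !subr_ge0 => /(_ lx) h1 /(_ (ltW k1) ly) h2; lra.
  rewrite /pairing !mulr_sumr -big_split/=; apply: eq_bigr => j _.
  by rewrite !mxE; ring.
apply: (@le_trans _ _ (pairing a (exponent R ab'.1 ab'.2))).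
  by rewrite pairing_exponent ler_nat lmin.
by apply: ler_sum => j _; rewrite ler_wpM2l.
Qed.

Lemma kappa_partE F (a : mi) l z : (forall j, (0 < a j)%N) ->
  kappa_part F (face F a l) z = \sum_(ab \in [set ab : mi * mi | (mdeg ab < l.+1)%N])
    if weight a ab == l then coef (F \o @of_real R n) ab * monomial (z 0) ab else 0.
Proof.
move=> a0; rewrite /kappa_part; set P := [set ab : mi * mi | _].
transitivity (\sum_(ab \in P) if weight a ab == l
    then coef (F \o @of_real R n) ab * monomial (z 0) ab else 0).
  apply: eq_fsbigr => ab /set_mem [_ /=]; rewrite pairing_exponent => /eqP.
  by rewrite eqr_nat => ->; rewrite taylor_coefE.
apply: fsbig_widen => [ab [_ /=]|ab [/= _ nP]].
  by rewrite pairing_exponent => /eqP; rewrite eqr_nat ltnS => /eqP <-; exact: mdeg_le_weight.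
case: eqP => // wl; have [->|/eqP c0] := eqVneq (coef (F \o @of_real R n) ab) 0.
  by rewrite mul0r.
by case: nP; split; [exact: newton_exponent|rewrite /= pairing_exponent wl].
Qed.

(* If eta_j = c_j t^(a_j) + higher order terms, then F o eta agrees with
   t |-> F_kappa (c t^a) up to O(t^(l+1)), l being the weight of the face
   kappa determined by a.  Components of high order are irrelevant. *)
Lemma composite_leading F (eta : R[i] -> 'rV[R[i]]_n) (a : mi) (c : 'rV[R[i]]_n) l :
  csmooth_at F 0 -> csmooth_map (onC1 eta) 0 -> eta 0 = 0 ->
  (forall j, (0 < a j)%N) ->
  (forall ab, coef (F \o @of_real R n) ab <> 0 -> (l <= weight a ab)%N) ->
  (forall j, vanishes (a j) (realify (fun t => eta t 0 j))) ->
  (forall j, (a j <= l)%N -> vanishes (a j).+1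
     (fun x => realify (fun t => eta t 0 j) x - c 0 j * zcoord x 0 ^+ a j)) ->
  vanishes l.+1 (fun x : E1 => realify (F \o eta) x -
    kappa_part F (face F a l) (\row_j (c 0 j * zcoord x 0 ^+ a j))).
Proof.
move=> sF se e0 a0 lmin va vc.
have e0' : onC1 eta 0 = 0 by rewrite /onC1 mxE.
set G := F \o @of_real R n; have sG : csmooth0 G by exact/csmooth0_at.
pose e j x := realify (fun t => eta t 0 j) x.
pose g j (x : E1) := c 0 j * zcoord x 0 ^+ a j.
have vg j : vanishes (a j) (g j).
  apply: vanishesZ; elim: (a j) => [|k IH]; first exact: vanishes_cst.
  apply: vanishes_near (vanishesM (@vanishes_letter R 1 (false, ord0)) IH).
  by apply: filterE => x; rewrite exprS.
pose D := [set ab : mi * mi | (mdeg ab < l.+1)%N].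
have fD : finite_set D by exact: finite_mdeg_lt.
have zE x j : zcoord (real_map (onC1 eta) x) j = e j x.
  by rewrite zcoord_to_realE.
have T1 : vanishes l.+1 (fun x => realify (F \o eta) x -
    \sum_(ab \in D) coef G ab * monomial (e ^~ x) ab).
  have [C C0 HC] := vanishes_pos (taylor_multiindex l.+1 sG).
  have [|K K0 HK] := @vanishes_norm R 1 n 1 (real_map (onC1 eta)).
    move=> j; under eq_fun do rewrite zE.
    exact: vanishesW (a0 j) (va j).
  have HC' : \forall y \near to_real (onC1 eta 0), normc (G y -
      \sum_(ab \in D) coef G ab * monomial (zcoord y) ab) <= C * `|y| ^+ l.+1.
    by rewrite e0' to_real0.
  have := near_real_map se HC'; rewrite to_real0 => HC1.
  exists (C * K ^+ l.+1); apply: filterS2 HC1 HK => x H1 H2.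
  rewrite (_ : realify (F \o eta) x - _ = G (real_map (onC1 eta) x) -
      \sum_(ab \in D) coef G ab * monomial (zcoord (real_map (onC1 eta) x)) ab); last first.
    congr (_ - _); first by rewrite /G /real_map /= to_realK.
    apply: eq_fsbigr => ab _; congr (_ * monomial _ _).
    by apply/funext => j; rewrite zE.
  rewrite (le_trans H1)// -mulrA ler_pM2l// -exprMn.
  by rewrite lerXn2r ?nnegrE ?mulr_ge0 -1?[`|x|]expr1.
have T2 : vanishes l.+1 (fun x => \sum_(ab \in D) coef G ab * monomial (e ^~ x) ab -
    kappa_part F (face F a l) (\row_j (c 0 j * zcoord x 0 ^+ a j))).
  have step ab : vanishes l.+1 (fun x => coef G ab * monomial (e ^~ x) ab -
      if weight a ab == l then coef G ab * monomial (g ^~ x) ab else 0).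
    have [c0|/eqP c0] := eqVneq (coef G ab) 0.
      apply: vanishes_near (vanishes0 _ _ _); apply: filterE => x.
      by rewrite c0 !mul0r; case: ifP; rewrite subrr.
    have := lmin _ c0; rewrite leq_eqVlt => /orP[/eqP wl|wl].
      rewrite -wl eqxx; have [|_ _ H] := @same_leading_monomial R 1 n a e g ab.
        move=> j ab0; have aj : (a j <= l)%N by rewrite wl; exact: weight_ge.
        by split; [exact: va|exact: vg|exact: vc].
      rewrite -wl in H.
      apply: vanishes_near (vanishesZ (coef G ab) H); apply: filterE => x.
      by rewrite mulrBr.
    rewrite (gtn_eqF wl).
    have [|H _ _] := @same_leading_monomial R 1 n a e e ab.
      move=> j _; split; [exact: va|exact: va|].
      by apply: vanishes_near (vanishes0 _ _ _); apply: filterE => x; rewrite subrr.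
    apply: vanishes_near (vanishesZ (coef G ab) (vanishesW wl H)).
    by apply: filterE => x; rewrite subr0.
  apply: vanishes_near (vanishes_sum (finmap.enum_fset (fset_set D)) step).
  apply: filterE => x; rewrite sumrB (kappa_partE _ _ _ a0).
  rewrite fsbig_finite; last exact: fD.
  rewrite [X in _ = _ - X]fsbig_finite; last exact: fD.
  congr (_ - _); apply: eq_bigr => ab _; case: ifP => // _; congr (_ * monomial _ _).
  by apply/funext => j; rewrite mxE.
apply: vanishes_near (vanishesD T1 T2); apply: filterE => x.
by rewrite addrA subrK.
Qed.

Lemma order_comp_le F (eta : R[i] -> 'rV[R[i]]_n) j0 (m d : nat) :
  csmooth_at F 0 -> nondegenerate F -> csmooth_map (onC1 eta) 0 -> eta 0 = 0 ->
  (forall j, \forall x \near (0 : E1),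
     wirtinger (true, ord0) (realify (fun t => eta t 0 j)) x = 0) ->
  order (fun t => eta t 0 j0) = m%:R%:E -> order (F \o axis j0) = d%:R%:E ->
  (order (F \o eta) <= (m * d)%:R%:E)%E.
Proof.
move=> sF nd se e0 hol om od.
have see j : csmooth0 (realify (fun t => eta t 0 j)) by exact/csmooth0_at/se.
(* A component vanishing to infinite order gets a weight beyond m * d and the
   arbitrary coefficient 1: it does not occur in the face part. *)
have /choice[ac Hac] : forall j, exists ac : nat * R[i],
    [/\ (0 < ac.1)%N, ac.2 != 0, vanishes ac.1 (realify (fun t => eta t 0 j)),
        (ac.1 <= m * d)%N -> vanishes ac.1.+1
          (fun x => realify (fun t => eta t 0 j) x - ac.2 * zcoord x 0 ^+ ac.1) &
        forall k, order (fun t => eta t 0 j) = k%:R%:E -> ac.1 = k].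
  move=> j; have o1 : (1%:E <= order (fun t => eta t 0%R j))%E.
    by apply: order_ge1 => //; rewrite e0 mxE.
  have := order_ge _ (see j); have := @leading_term _ _ _ (see j) (hol j).
  case: (orderP (fun t => eta t 0 j)) o1 => [_ _ _ oge|k a b _ _ _ k1 lt oge].
    exists ((m * d).+1, 1); split; rewrite /= ?oner_neq0 ?ltnn//.
    by apply/oge; rewrite leey.
  have [c c0 vc] := lt k erefl; exists (k, c); split=> //=.
  - by rewrite lee_fin ler1n in k1.
  - exact/oge.
  - by move=> k' [/eqP]; rewrite eqr_nat => /eqP.
pose a : mi := [ffun j => (ac j).1]; pose c : 'rV[R[i]]_n := \row_j (ac j).2.
have a0 j : (0 < a j)%N by rewrite ffunE; case: (Hac j).
have aj0 : a j0 = m by rewrite ffunE; case: (Hac j0) => _ _ _ _; exact.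
have c0 j : c 0 j != 0 by rewrite mxE; case: (Hac j).
have [p [q [dpq cpq]]] : exists p q, d = (p + q)%N /\
    coef (F \o @of_real R n) (axis_mi j0 p q) <> 0.
  move: od; case: (orderP (F \o axis j0)) => // d' p q -> cpq _ [/eqP].
  by rewrite eqr_nat => /eqP <-; exists p, q; rewrite coef_axis.
pose wt l := exists ab : mi * mi, coef (F \o @of_real R n) ab <> 0 /\ weight a ab = l.
have wmd : wt (m * d)%N.
  by exists (axis_mi j0 p q); rewrite weight_axis aj0 dpq.
have exw : exists l, `[< wt l >] by exists (m * d)%N; apply/asboolP.
case: (ex_minnP exw) => l /asboolP[ab [cab wab]] lmin.
have lmd : (l <= m * d)%N by apply: lmin; apply/asboolP.
have lw ab' : coef (F \o @of_real R n) ab' <> 0 -> (l <= weight a ab')%N.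
  by move=> cab'; apply: lmin; apply/asboolP; exists ab'.
have det : determines F a (face F a l).
  by rewrite -wab; apply: face_determined => // ab' /lw; rewrite wab.
have [t] := nd _ (ex_intro _ a det) c a c0 det; apply: contra_notP => /negP.
rewrite -ltNge => olt.
have sFe : csmooth0 (realify (F \o eta)) by apply: csmooth_comp_curve => //; rewrite e0.
have vFe : vanishes l.+1 (realify (F \o eta)).
  apply/(order_ge _ sFe); move: olt.
  case: (orderP (F \o eta)) => [_ _|k ? ? _ _ _]; first by rewrite leey.
  by rewrite lte_fin lee_fin ltr_nat ler_nat; exact: leq_ltn_trans.
pose K (x : E1) := kappa_part F (face F a l) (\row_j (c 0 j * zcoord x 0 ^+ a j)).
have vK : vanishes l.+1 K.
  have va j : vanishes (a j) (realify (fun t => eta t 0 j)).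
    by rewrite ffunE; case: (Hac j).
  have vc j : (a j <= l)%N -> vanishes (a j).+1
      (fun x => realify (fun t => eta t 0 j) x - c 0 j * zcoord x 0 ^+ a j).
    rewrite ffunE mxE => al; case: (Hac j) => _ _ _ H _; apply: H.
    exact: leq_trans al lmd.
  apply: vanishes_near (vanishesB vFe (composite_leading sF se e0 a0 lw va vc)).
  by apply: filterE => x; rewrite opprB addrC subrK.
have Ks (s : R) x : K (s *: x) = s%:C ^+ l * K x.
  rewrite /K !kappa_partE// mulr_fsumr; apply: eq_fsbigr => ab' _.
  case: eqP => [wl|_]; last by rewrite mulr0.
  rewrite mulrCA; congr (_ * _).
  have mE u : monomial ((\row_j (c 0 j * u ^+ a j) : 'rV_n) 0) ab' =
      monomial (fun j => c 0 j * u ^+ a j) ab'.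
    by congr (monomial _ _); apply/funext => j; rewrite mxE.
  by rewrite !mE /zcoord letterZ monomial_weighted wl.
have := vanishes_homogeneous Ks vK (to_real (const_mx t : 'rV_1)).
by rewrite /K zcoord_to_real.
Qed.

End Nondegenerate.

(** * Holomorphic curves *)

Section Curves.
Variables (R : realType) (n : nat).
Local Notation E1 := ('rV[R]_1 * 'rV[R]_1)%type.
Implicit Types (p : 'rV[R[i]]_n) (gamma : R[i] -> 'rV[R[i]]_n).

Lemma near_cnbhs0 k (P : 'rV[R[i]]_k -> Prop) :
  (\forall z \near cnbhs (0 : 'rV[R[i]]_k), P z) <->
  \forall x \near (0 : 'rV[R]_k * 'rV[R]_k), P (of_real x).
Proof. by rewrite /cnbhs to_real0. Qed.

Lemma holomorphic_csmooth k m (f : 'rV[R[i]]_k -> 'rV[R[i]]_m) q :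
  holomorphic_at f q -> csmooth_map f q.
Proof. by move=> hf j; case: (hf j). Qed.

Lemma holomorphic_wirtinger k m (f : 'rV[R[i]]_k -> 'rV[R[i]]_m) q i :
  holomorphic_at f q -> \forall x \near to_real q, forall j,
    wirtinger (true, j) ((fun w => f w 0 i) \o @of_real R k) x = 0.
Proof.
move=> hf; have : \forall x \near to_real q, forall j,
    dzbar j (fun w => f w 0 i) (of_real x) = 0 by case: (hf i).
by apply: filterS => x H j; rewrite -wirtinger_dzbar /= H.
Qed.

Lemma holomorphic_comp k m (f : 'rV[R[i]]_k -> 'rV[R[i]]_m)
    (g : 'rV[R[i]]_1 -> 'rV[R[i]]_k) :
  holomorphic_at g 0 -> holomorphic_at f (g 0) -> holomorphic_at (f \o g) 0.
Proof.
move=> hg hf i; have sg := holomorphic_csmooth hg; have sf := holomorphic_csmooth hf.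
split; first exact: csmooth_at_comp sg (sf i).
apply/near_cnbhs0.
have [U [oU U0 sU]] := csmooth_mapP sg.
have /csmooth_atP[V [oV Vg sV]] := sf i.
have nV : \forall y \near to_real (g 0), V y by exact: (open_nbhs_nbhs (conj oV Vg)).
have nU : \forall x \near to_real 0, U x by exact: (open_nbhs_nbhs (conj oU U0)).
have := near_real_map sg (holomorphic_wirtinger i hf).
have := near_real_map sg nV; move: nU.
have : \forall x \near to_real (0 : 'rV[R[i]]_1), forall l j,
    wirtinger (true, j) ((fun w => g w 0 l) \o @of_real R 1) x = 0.
  by apply: near_forall => l; exact: holomorphic_wirtinger.
rewrite to_real0 => H1 H2 H3 H4.
apply: filterS2 (filterI H1 H2) (filterI H3 H4) => x [hgx Ux] [Vx hfx] j.
rewrite -[dzbar _ _ _]/((dzbar j (fun w => (f \o g) w 0 i) \o @of_real R 1) x).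
rewrite wirtinger_dzbar.
have -> : (fun w => (f \o g) w 0 i) \o @of_real R 1 =
    ((fun w => f w 0 i) \o @of_real R k) \o real_map g.
  by apply/funext => y; rewrite /real_map /= to_realK.
apply: wirtinger_comp => //.
- by move=> l; exact: (sU l [::]).
- exact: csmooth_diff sV Vx.
- by move=> l; exact: hgx.
Qed.

Lemma real_map_axis j (x : E1) : real_map (onC1 (@axis R n j)) x = real_axis j x.
Proof. by rewrite /real_map /onC1 /= -of_real_axis of_realK. Qed.

Lemma holomorphic_comp_axis (f : 'rV[R[i]]_n -> 'rV[R[i]]_n) (j : 'I_n) :
  holomorphic_at f 0 -> holomorphic_at (onC1 (f \o axis j)) 0.
Proof.
move=> hf k; have sf := holomorphic_csmooth hf; have sa := csmooth_axis R j.
have a0 : onC1 (@axis R n j) 0 = 0 by rewrite /onC1 mxE axis0.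
split.
  apply: (@csmooth_at_comp _ _ _ (onC1 (axis j)) 0 (fun w => f w 0 k)) => //.
  by rewrite a0; exact: sf.
apply/near_cnbhs0; have := holomorphic_wirtinger k hf; rewrite -a0 => H.
have := near_real_map sa H; rewrite to_real0; apply: filterS => x Hx i.
rewrite (ord1 i).
rewrite -[dzbar _ _ _]/((dzbar ord0 (fun w => onC1 (f \o axis j) w 0 k) \o @of_real R 1) x).
rewrite wirtinger_dzbar.
have -> : (fun w => onC1 (f \o axis j) w 0 k) \o @of_real R 1 =
    ((fun w => f w 0 k) \o @of_real R n) \o real_axis j.
  by apply/funext => y; rewrite /onC1 /= of_real_axis.
by rewrite -wirtinger_axis -real_map_axis; exact: Hx.
Qed.

Lemma vorder_geP (h : R[i] -> 'rV[R[i]]_n) d :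
  (forall j, csmooth0 (realify (fun t => h t 0 j))) ->
  (d%:R%:E <= vorder h)%E <-> forall j, vanishes d (realify (fun t => h t 0 j)).
Proof.
move=> sh; split=> [/bigmin_geP[_ H] j|H].
  by apply/(order_ge d (sh j)); exact: H.
apply/bigmin_geP; split; first by rewrite leey.
by move=> j _; apply/(order_ge d (sh j)).
Qed.

Lemma vorderP (h : R[i] -> 'rV[R[i]]_n) : vorder h = +oo%E \/
  exists d : nat, vorder h = d%:R%:E.
Proof.
rewrite /vorder; elim/big_ind: _ => [|x y|j _]; first by left.
- by move=> Hx Hy; rewrite minEle; case: ifP.
- by case: orderP => [_|d *]; [left|right; exists d].
Qed.

Variable p : 'rV[R[i]]_n.
Variables (zeta phi : 'rV[R[i]]_n -> 'rV[R[i]]_n).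
Hypothesis hz : holomorphic_coordinate p zeta phi.

Lemma phi_zeta gamma : csmooth_map (onC1 gamma) 0 -> gamma 0 = p ->
  \forall x \near (0 : E1), phi (zeta (gamma (of_real x 0 0))) = gamma (of_real x 0 0).
Proof.
move=> sg g0; have [_ _ _ _ [Hz _]] := hz.
have g0' : onC1 gamma 0 = p by rewrite /onC1 mxE.
have H : \forall y \near to_real (onC1 gamma 0), phi (zeta (of_real y)) = of_real y.
  by rewrite g0'.
have := near_real_map sg H; rewrite to_real0; apply: filterS => x.
by rewrite /real_map /= to_realK.
Qed.

Lemma zeta_phi eta : csmooth_map (onC1 eta) 0 -> eta 0 = 0 ->
  \forall x \near (0 : E1), zeta (phi (eta (of_real x 0 0))) = eta (of_real x 0 0).
Proof.
move=> sg g0; have [_ _ _ _ [_ Hz]] := hz.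
have g0' : onC1 eta 0 = 0 by rewrite /onC1 mxE.
have H : \forall y \near to_real (onC1 eta 0), zeta (phi (of_real y)) = of_real y.
  by rewrite g0'.
have := near_real_map sg H; rewrite to_real0; apply: filterS => x.
by rewrite /real_map /= to_realK.
Qed.

Lemma csmooth_map_sub gamma j : csmooth_map (onC1 gamma) 0 ->
  csmooth0 (realify (fun t => (gamma t - p) 0 j)).
Proof.
move=> sg; have [U [oU U0 sU]] := (csmooth0_at _).1 (sg j).
exists U; split=> //; apply: csmooth_ext oU _ (csmoothD oU sU (csmooth_cst U (- p 0 j))) => x _.
by rewrite /realify /onC1 /= !mxE.
Qed.

Lemma axis_curve_order1 (j : 'I_n) :
  ~ forall k, vanishes 2 (realify (fun t => (phi (axis j t) - p) 0 k)).
Proof.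
have [hzeta hphi z0 p0 _] := hz => H.
have hg := holomorphic_comp_axis j hphi.
have sg := holomorphic_csmooth hg.
have sa := csmooth_axis R j.
have g0 : onC1 (phi \o axis j) 0 = p by rewrite /onC1 /= mxE axis0.
have sz : csmooth_map zeta (onC1 (phi \o axis j) 0).
  by rewrite g0; exact: holomorphic_csmooth.
have := @vanishes_map _ _ _ _ 2 _ _ sg sz _ j.
rewrite g0 z0 => V.
have : vanishes 2 (fun x : E1 => zcoord x 0).
  apply: vanishes_near (V _); last first.
    move=> k; apply: vanishes_near (H k); apply: filterE => x.
    by rewrite /realify /onC1 /= mxE [X in _ + X]mxE.
  apply: filterS (zeta_phi sa (axis0 _ j)) => x Hx; rewrite /onC1 /= Hx.
  by rewrite /axis !mxE !eqxx mulr1 subr0.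
have hom (s : R) (x : E1) : zcoord (s *: x) 0 = s%:C ^+ 1 * zcoord x 0.
  by rewrite expr1 /zcoord letterZ.
move=> /(vanishes_homogeneous hom)/(_ (to_real (const_mx 1 : 'rV[R[i]]_1))).
by move/(etrans (esym (zcoord_to_real 1)))/eqP; rewrite oner_eq0.
Qed.

Lemma axis_curve_Gamma (j : 'I_n) : Gamma p (phi \o axis j).
Proof.
have [hzeta hphi z0 p0 _] := hz; split.
- exact: holomorphic_comp_axis.
- by rewrite /= axis0.
- move=> /near_cnbhs0 Hc; apply: (@axis_curve_order1 j) => k.
  apply: vanishes_near (vanishes0 _ _ 2); apply: filterS Hc => x.
  by rewrite /realify /onC1 /= => ->; rewrite subrr mxE.
Qed.

Lemma vorder_ge1 gamma : csmooth_map (onC1 gamma) 0 -> gamma 0 = p ->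
  (1%:E <= vorder (fun t => (gamma t - p)%R))%E.
Proof.
move=> sg g0; apply/bigmin_geP; split; first by rewrite leey.
move=> k _; apply: order_ge1; first exact: csmooth_map_sub.
by rewrite g0 subrr mxE.
Qed.

Lemma axis_curve_Gamma_reg (j : 'I_n) : Gamma_reg p (phi \o axis j).
Proof.
have Gj := axis_curve_Gamma j; split=> //.
have [hg g0 _] := Gj; have sg := holomorphic_csmooth hg.
have := vorder_ge1 sg g0.
have := vorder_geP (h := fun t => (phi (axis j t) - p)%R) 2 (fun k => csmooth_map_sub k sg).
case: (vorderP (fun t => (phi (axis j t) - p)%R)) => [->|[d ->]] v2 v1.
  by case: (@axis_curve_order1 j); apply/v2; rewrite leey.
have d2 : ~ (2 <= d)%N.
  by move=> d2; apply: (@axis_curve_order1 j); apply/v2; rewrite lee_fin ler_nat.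
have d1 : (1 <= d)%N by move: v1; rewrite lee_fin -[1]/(1%:R) ler_nat.
have -> : d = 1%N by lia.
by [].
Qed.

End Curves.

Section Types.
Variables (R : realType) (n : nat) (M : set 'rV[R[i]]_n) (p : 'rV[R[i]]_n).
Hypothesis Mp : M p.
Implicit Types (r : 'rV[R[i]]_n -> R) (gamma : R[i] -> 'rV[R[i]]_n).

Lemma defining_function_eq0 r : local_defining_function M p r -> r p = 0.
Proof.
by move=> [_ zr _]; have := nbhs_singleton zr; rewrite /= to_realK => -[+ _]; apply.
Qed.

Lemma defining_function_dim r : local_defining_function M p r -> (0 < n)%N.
Proof.
move=> [_ zr gr]; rewrite lt0n; apply/eqP => n0.
have := nbhs_singleton gr; have := nbhs_singleton zr; rewrite /= to_realK.
move=> [/(_ Mp) r0 _] /(_ r0)/gradient_neq0[v].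
have -> : v = 0.
  by case: v => v1 v2; congr (_, _); apply/rowP => i; have := ltn_ord i; rewrite {2}n0.
by rewrite derive0 eqxx.
Qed.

Variables (zeta phi : 'rV[R[i]]_n -> 'rV[R[i]]_n).
Hypothesis hz : holomorphic_coordinate p zeta phi.

Lemma csmooth_pullback r : local_defining_function M p r ->
  csmooth_at (fun w => (r (phi w))%:C) 0.
Proof.
move=> [sr _ _]; have [_ hphi _ p0 _] := hz.
apply: (@csmooth_at_comp _ _ _ phi 0 (fun z => (r z)%:C)).
  exact: holomorphic_csmooth.
by rewrite p0; exact: csmooth_at_real.
Qed.

Lemma rho1_axis_curves r : local_defining_function M p r ->
  rho1 (fun w => (r (phi w))%:C) =
  \big[maxe/-oo%E]_(j < n) order (fun t => (r ((phi \o axis j) t))%:C).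
Proof.
move=> dr; have [_ _ _ p0 _] := hz; rewrite rho1E//.
- exact: csmooth_pullback.
- by rewrite p0 (defining_function_eq0 dr).
- exact: defining_function_dim dr.
Qed.

Lemma order_quotient_le r r0 gamma : local_defining_function M p r ->
  nondegenerate (fun w => (r (phi w))%:C) ->
  local_defining_function M p r0 -> Gamma p gamma ->
  (order (fun t => (r0 (gamma t))%:C) / vorder (fun t => (gamma t - p)%R) <=
   rho1 (fun w => (r0 (phi w))%:C))%E.
Proof.
move=> dr nd dr0 [hg g0 _]; have [hzeta hphi z0 p0 _] := hz.
have sg := holomorphic_csmooth hg.
have axisE j : order (fun t => (r0 ((phi \o axis j) t))%:C) =
    order (fun t => (r ((phi \o axis j) t))%:C).
  have [ha a0 _] := axis_curve_Gamma hz j.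
  exact: order_defining Mp dr0 dr (holomorphic_csmooth ha) a0.
rewrite (order_defining Mp dr0 dr sg g0) (rho1_axis_curves dr0).
under eq_bigr do rewrite axisE.
set F := fun w => (r (phi w))%:C in nd; set rho := \big[_/_]_(_ < _) _.
have rho_ge j : (order (F \o axis j) <= rho)%E by exact: le_bigmax.
have n0 := defining_function_dim dr; have sF := csmooth_pullback dr.
have rho0 : (0 <= rho)%E.
  apply: le_trans (rho_ge (Ordinal n0)).
  by case: (orderP (F \o _)) => [_|d *]; rewrite ?leey ?lee_fin.
set V := vorder _; have [->|[m vm]] : V = +oo%E \/ exists m : nat, V = m%:R%:E.
- exact: vorderP.
- by rewrite invey mule0.
have := vorder_ge1 sg g0; rewrite -/V vm lee_fin -[1]/(1%:R) ler_nat => m1.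
pose eta := zeta \o gamma.
have g0' : onC1 gamma 0 = p by rewrite /onC1 mxE.
have heta : holomorphic_at (onC1 eta) 0.
  by apply: (@holomorphic_comp _ _ _ zeta (onC1 gamma)) => //; rewrite g0'.
have seta := holomorphic_csmooth heta.
have eta0 : eta 0 = 0 by rewrite /eta /= g0.
have eta0' : onC1 eta 0 = 0 by rewrite /onC1 mxE.
have see j : csmooth0 (realify (fun t => eta t 0 j)) by exact/csmooth0_at/seta.
have [j0 nv] : exists j0, ~ vanishes m.+1 (realify (fun t => eta t 0 j0)).
  apply/existsNP => ve; have : (m.+1%:R%:E <= V)%E.
    apply/(vorder_geP _ (fun k => csmooth_map_sub _ k sg)) => k.
    have sphi : csmooth_map phi (onC1 eta 0) by rewrite eta0'; exact: holomorphic_csmooth.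
    have := @vanishes_map _ _ _ _ m.+1 _ _ seta sphi _ k; rewrite eta0' p0 => vphi.
    apply: vanishes_near (vphi _); last first.
      by move=> j; apply: vanishes_near (ve j); apply: filterE => x; rewrite [in RHS]mxE subr0.
    apply: filterS (phi_zeta hz sg g0) => x Hx.
    rewrite -[onC1 eta _]/(zeta (gamma (of_real x 0 0))) Hx.
    by rewrite /realify /onC1 /= [RHS]mxE [X in _ = _ + X]mxE.
  by rewrite vm lee_fin ler_nat ltnn.
have [m' m'E m'm] : exists2 m' : nat, order (fun t => eta t 0 j0) = m'%:R%:E & (m' <= m)%N.
  have := order_ge m.+1 (see j0); case: (orderP (fun t => eta t 0 j0)) => [_|m' ? ? _ _ _] og.
    by case: nv; apply/og; rewrite leey.
  exists m' => //; rewrite leqNgt; apply/negP => mm'.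
  by apply/nv/og; rewrite lee_fin ler_nat.
have -> : order (fun t => (r (gamma t))%:C) = order (F \o eta).
  have sr : csmooth0 (realify (fun t => (r (gamma t))%:C)).
    have [sr _ _] := dr.
    apply: (@csmooth_comp_curve _ _ (fun z => (r z)%:C) gamma) => //.
    by rewrite g0; exact: csmooth_at_real.
  have sFe : csmooth0 (realify (F \o eta)) by apply: csmooth_comp_curve => //; rewrite eta0.
  have E : \forall x \near (0 : 'rV[R]_1 * 'rV[R]_1),
      realify (F \o eta) x = realify (fun t => (r (gamma t))%:C) x.
    apply: filterS (phi_zeta hz sg g0) => x Hx.
    by rewrite /realify /onC1 /F /eta /= Hx.
  apply/eqP; rewrite eq_le; apply/andP; split; apply: order_le => // d.
    by apply: vanishes_near; apply: filterS E.
  by apply: vanishes_near.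
have mp : 0 < m%:R :> R by rewrite ltr0n.
rewrite inver gt_eqF// lee_pdivrMr//.
have := rho_ge j0; have := @order_comp_le _ _ F eta j0 m' _ sF nd seta eta0 _ m'E.
case: (orderP (F \o axis j0)) => [_ _|d a b _ _ _ H drho].
  by rewrite leye_eq => /eqP ->; rewrite gt0_mulye ?leey.
apply: le_trans (H d _ erefl) _.
  move=> j; have := holomorphic_wirtinger j heta; rewrite to_real0.
  by apply: filterS => x Hx; exact: Hx.
apply: (@le_trans _ _ (d%:R%:E * m%:R%:E)%E).
  by rewrite -EFinM lee_fin -natrM ler_nat mulnC leq_mul2l m'm orbT.
by rewrite lee_pmul2r.
Qed.

End Types.

Theorem theorem1p3 (R : realType) (n : nat) (M : set 'rV[R[i]]_n)
    (p : 'rV[R[i]]_n) (hM : smooth_real_hypersurface M) (hp : M p)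
    (zeta phi : 'rV[R[i]]_n -> 'rV[R[i]]_n)
    (hz : holomorphic_coordinate p zeta phi)
    (hnd : exists r : 'rV[R[i]]_n -> R,
       local_defining_function M p r /\
       nondegenerate (fun w => (r (phi w))%:C))
    (r0 : 'rV[R[i]]_n -> R) (hr0 : local_defining_function M p r0) :
  Delta1 p r0 = Delta1_reg p r0 /\
  Delta1_reg p r0 = rho1 (fun w => (r0 (phi w))%:C).
Proof.
have [r [dr nd]] := hnd.
have Drho : (Delta1 p r0 <= rho1 (fun w => (r0 (phi w))%:C))%E.
  by apply: ge_ereal_sup => _ [gamma Gg <-]; exact: (order_quotient_le hp hz dr nd hr0 Gg).
have rhoreg : (rho1 (fun w => (r0 (phi w))%:C) <= Delta1_reg p r0)%E.
  rewrite (rho1_axis_curves hp hz hr0); apply/bigmax_leP; split; first exact: leNye.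
  move=> j _; apply: ereal_sup_ubound; exists (phi \o axis j) => //.
  exact: axis_curve_Gamma_reg hz j.
have regD : (Delta1_reg p r0 <= Delta1 p r0)%E.
  apply: ge_ereal_sup => _ [gamma [Gg v1] <-]; apply: ereal_sup_ubound.
  by exists gamma => //; rewrite v1 inve1 mule1.
split; apply/eqP; rewrite eq_le.
  by rewrite regD (le_trans Drho).
by rewrite rhoreg (le_trans regD).
Qed.
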